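(* Let $p,q\ge 0$ be integers and let $\mathbf{B}=\{V_1,\dots,V_{p+q}\}$ be a set of matrices (with entries in $\mathbf{R}$, $\mathbf{C}$ or $\mathbf{H}$) serving as a basis of one-vectors for $\mathrm{Cl}(p,q)$ such that (BP1) $V_i^{*}=\pm V_i$ for every $i$ (the sign may depend on $i$); (BP2) the elements of $\mathbf{B}$ are pairwise orthogonal for the trace inner product: for all $U,V\in\mathbf{B}$ with $U\ne V$, $\mathrm{Tr}(U^{*}V)=0$ if $\mathbf{B}$ consists of real or complex matrices, and $\mathrm{Re}(\mathrm{Tr}(U^{*}V))=0$ if $\mathbf{B}$ contains quaternionic matrices. Let $\Phi_{p,q}:\mathrm{Spin}^{+}(p,q)\to SO^{+}(p,q)$ be the covering map determined by $\mathbf{B}$, and let $P\in SO^{+}(p,q)$ be (symmetric) positive definite. Then there is a unique positive definite $Y\in \mathrm{Spin}^{+}(p,q)$ with $\Phi_{p,q}(Y)=P$.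
   Context: $X^{*}$ denotes conjugate transpose (complex or quaternionic conjugation entrywise, then transposition). Write $n=p+q$. A basis of one-vectors for $\mathrm{Cl}(p,q)$ is a collection of square matrices $X_1,\dots,X_{n}$ of the same size, with entries in $\mathbf{R}$, $\mathbf{C}$ or $\mathbf{H}$, with $X_i^2=I$ for $1\le i\le p$, $X_i^2=-I$ for $p+1\le i\le n$, and $X_iX_j=-X_jX_i$ for $i\neq j$, such that the real algebra they generate is (isomorphic to) the Clifford algebra $\mathrm{Cl}(p,q)$, of real dimension $2^{n}$; this algebra is identified with $\mathrm{Cl}(p,q)$. One-vectors are real linear combinations of the $X_i$. Even elements are the real linear combinations of products of an even number of the $X_i$ (equivalently, elements fixed by the grade involution). Clifford conjugation $x\mapsto x^{cc}$ is the real-linear anti-automorphism of $\mathrm{Cl}(p,q)$ with $X_i^{cc}=-X_i$. $\mathrm{Spin}^{+}(p,q)$ is the connected component of the identity of the group of even $x\in\mathrm{Cl}(p,q)$ with $xx^{cc}=1$ and such that $xvx^{cc}$ is a one-vector for every one-vector $v$. $I_{p,q}=I_p\oplus(-I_q)$; $SO(p,q)=\{X\in M(n,\mathbf{R}): X^TI_{p,q}X=I_{p,q},\ \det X=1\}$, and $SO^{+}(p,q)$ is its identity component. $\Phi_{p,q}$ sends $x$ to the matrix, with respect to the basis $\{X_1,\dots,X_n\}$, of the linear map $v\mapsto xvx^{cc}$ on one-vectors. A matrix $Y\in M(m,\mathbf{K})$, $\mathbf{K}\in\{\mathbf{R},\mathbf{C},\mathbf{H}\}$, is positive definite if $Y^*=Y$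 and $v^{*}Yv>0$ for all nonzero $v\in\mathbf{K}^m$. *)

(* Defs.v *)
(* MathComp-Analysis; the real numbers are an arbitrary [R : realType]. *)
From HB Require Import structures.
From mathcomp Require Import all_boot all_order all_algebra ring.
From mathcomp Require Import all_classical all_reals all_analysis.
From mathcomp Require Import complex.

Set Implicit Arguments.
Unset Strict Implicit.
Unset Printing Implicit Defensive.

Import Order.TTheory GRing.Theory Num.Theory.
Import numFieldNormedType.Exports.

Local Open Scope classical_set_scope.
Local Open Scope ring_scope.

Record quaternion (R : Type) : Type := Quaternion {
  qr : R; qi : R; qj : R; qk : R }.

Section QuaternionStructures.
Variable R : realType.
Implicit Types x y z : quaternion R.

Definition quaternion_coords x : R * R * R * R := (qr x, qi x, qj x, qk x).
Definition coords_quaternion (v : R * R * R * R) : quaternion R :=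
  Quaternion v.1.1.1 v.1.1.2 v.1.2 v.2.

Lemma quaternion_coordsK : cancel quaternion_coords coords_quaternion.
Proof. by case. Qed.

HB.instance Definition _ :=
  Choice.copy (quaternion R) (can_type quaternion_coordsK).
(* The topology of R^4. *)
HB.instance Definition _ :=
  Topological.copy (quaternion R) (initial_topology quaternion_coords).

Definition quat_add x y :=
  Quaternion (qr x + qr y) (qi x + qi y) (qj x + qj y) (qk x + qk y).
Definition quat_opp x := Quaternion (- qr x) (- qi x) (- qj x) (- qk x).
Definition quat_mul x y := Quaternion
  (qr x * qr y - qi x * qi y - qj x * qj y - qk x * qk y)
  (qr x * qi y + qi x * qr y + qj x * qk y - qk x * qj y)
  (qr x * qj y - qi x * qk y + qj x * qr y + qk x * qi y)
  (qr x * qk y + qi x * qj y - qj x * qi y + qk x * qr y).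
Definition quat_conj x := Quaternion (qr x) (- qi x) (- qj x) (- qk x).
Definition quat_real (r : R) : quaternion R := Quaternion r 0 0 0.

Let quat_addA : associative quat_add.
Proof. by move=> x y z; rewrite /quat_add /= !addrA. Qed.
Let quat_addC : commutative quat_add.
Proof. by move=> x y; congr Quaternion; exact: addrC. Qed.
Let quat_add0 : left_id (quat_real 0) quat_add.
Proof. by case=> a b c d; rewrite /quat_add /= !add0r. Qed.
Let quat_addN : left_inverse (quat_real 0) quat_opp quat_add.
Proof. by case=> a b c d; rewrite /quat_add /= !addNr. Qed.

HB.instance Definition _ :=
  GRing.isZmodule.Build (quaternion R) quat_addA quat_addC quat_add0 quat_addN.

Let quat_mulA : associative quat_mul.
Proof. by move=> x y z; congr Quaternion => /=; ring. Qed.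
Let quat_mul1l : left_id (quat_real 1) quat_mul.
Proof. by case=> a b c d; congr Quaternion => /=; ring. Qed.
Let quat_mul1r : right_id (quat_real 1) quat_mul.
Proof. by case=> a b c d; congr Quaternion => /=; ring. Qed.
Let quat_mulDl : left_distributive quat_mul quat_add.
Proof. by move=> x y z; congr Quaternion => /=; ring. Qed.
Let quat_mulDr : right_distributive quat_mul quat_add.
Proof. by move=> x y z; congr Quaternion => /=; ring. Qed.
Let quat_one_neq0 : quat_real 1 != 0.
Proof. by apply/eqP => -[] /eqP; rewrite oner_eq0. Qed.

HB.instance Definition _ := GRing.Zmodule_isNzRing.Build (quaternion R)
  quat_mulA quat_mul1l quat_mul1r quat_mulDl quat_mulDr quat_one_neq0.

End QuaternionStructures.

(* The interface shared by R, C and H: conjugation, real part, and the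
   embedding of R.  It carries no axioms because it is only ever used at the
   three instances below (see [scalars]). *)
HB.mixin Record isScalar (R : realType) K of GRing.NzRing K & Topological K := {
  sconj : K -> K;
  sre : K -> R;
  sreal : R -> K }.
#[short(type="scalarType")]
HB.structure Definition Scalar (R : realType) :=
  {K of isScalar R K & GRing.NzRing K & Topological K}.

Definition realK (R : realType) : Type := R.
HB.instance Definition _ (R : realType) := GRing.NzRing.copy (realK R) R.
HB.instance Definition _ (R : realType) := Topological.copy (realK R) R.
HB.instance Definition _ (R : realType) :=
  isScalar.Build R (realK R) id id id.

HB.instance Definition _ (R : realType) := Topological.copy R[i] R[i]^o.
HB.instance Definition _ (R : realType) :=
  isScalar.Build R R[i] (@conjc R) (@complex.Re R) (fun r => Complex r 0).

HB.instance Definition _ (R : realType) :=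
  isScalar.Build R (quaternion R) (@quat_conj R) (@qr R) (@quat_real R).

Variant division_algebra := Reals | Complexes | Quaternions.

Definition scalars (R : realType) (k : division_algebra) : scalarType R :=
  match k with
  | Reals => realK R
  | Complexes => R[i]
  | Quaternions => quaternion R
  end.

Section Matrices.
Variables (R : realType) (K : scalarType R).

Definition adjmx (m n : nat) (X : 'M[K]_(m, n)) : 'M[K]_(n, m) :=
  (map_mx (@sconj R K) X)^T.

(* [v^* Y v > 0] says that [v^* Y v] is a positive real; no order on K is
   needed. *)
Definition posdef (m : nat) (Y : 'M[K]_m) : Prop :=
  adjmx Y = Y /\
  forall v : 'cV[K]_m, v != 0 ->
    exists2 r : R, 0 < r & (adjmx v *m Y *m v) 0 0 = sreal r.

Definition rscale (m : nat) (r : R) (X : 'M[K]_m) : 'M[K]_m :=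
  (sreal r : K) *: X.

Definition real_span (m : nat) (A : set 'M[K]_m) : set 'M[K]_m :=
  [set x | exists (d : nat) (c : 'I_d -> R) (b : 'I_d -> 'M[K]_m),
     (forall i, A (b i)) /\ x = \sum_i rscale (c i) (b i)].

Definition real_free (m d : nat) (b : 'I_d -> 'M[K]_m) : Prop :=
  forall c : 'I_d -> R, \sum_i rscale (c i) (b i) = 0 -> forall i, c i = 0.

Definition has_real_dim (m : nat) (A : set 'M[K]_m) (d : nat) : Prop :=
  exists b : 'I_d -> 'M[K]_m, real_free b /\ real_span (range b) = A.

End Matrices.

Definition trace_orthogonal (R : realType) (k : division_algebra) (m : nat)
    (U V : 'M[scalars R k]_m) : Prop :=
  match k with
  | Reals | Complexes => \tr (adjmx U *m V) = 0
  | Quaternions => sre (\tr (adjmx U *m V)) = 0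
  end.

(* The index type is 'I_(p + q), so the p generators of square 1 are those of
   value < p. *)
Definition clifford_relations (p q : nat) (A : pzRingType)
    (a : 'I_(p + q) -> A) : Prop :=
  (forall i, a i * a i = if (i < p)%N then 1 else - 1) /\
  (forall i j, i != j -> a i * a j = - (a j * a i)).

Section OneVectors.
Variables (R : realType) (K : scalarType R) (n m : nat).
Variable X : 'I_n -> 'M[K]_m.

Definition word (s : seq 'I_n) : 'M[K]_m := \prod_(i <- s) X i.

Definition generated_algebra : set 'M[K]_m := real_span (range word).

Definition even_elements : set 'M[K]_m :=
  real_span (word @` [set s | ~~ odd (size s)]).

Definition one_vectors : set 'M[K]_m := real_span (range X).

Definition clifford_conjugation (f : 'M[K]_m -> 'M[K]_m) : Prop :=
  let A := generated_algebra in
  [/\ set_bij A A f,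
      forall i, f (X i) = - X i,
      forall x y, A x -> A y -> f (x + y) = f x + f y,
      forall r x, A x -> f (rscale r x) = rscale r (f x) &
      f 1 = 1 /\ forall x y, A x -> A y -> f (x * y) = f y * f x].

(* The value at x of the Clifford conjugation of the algebra generated by the
   one-vectors [X i].  A Clifford conjugation exists as soon as X is a basis of
   one-vectors, and its values on that algebra are determined by those at the
   [X i]; outside the algebra cc is meaningless. *)
Definition cc (x : 'M[K]_m) : 'M[K]_m :=
  xget 0 [set y | exists2 f, clifford_conjugation f & y = f x].

Definition spin_group : set 'M[K]_m :=
  [set x | [/\ even_elements x, x * cc x = 1 &
     forall v, one_vectors v -> one_vectors (x * v * cc x)]].

Definition spin_plus : set 'M[K]_m := connected_component spin_group 1.

(* The matrix of [v |-> x v x^cc] in the basis X, which is well defined when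
   that map preserves one-vectors and X is linearly independent. *)
Definition Phi (x : 'M[K]_m) : 'M[R]_n :=
  xget 0 [set M : 'M[R]_n |
    forall j, x * X j * cc x = \sum_i rscale (M i j) (X i)].

End OneVectors.

(* The algebra generated by X is the Clifford algebra Cl(p, q): it is universal
   among the real algebras with generators satisfying the Clifford relations
   (the factorization is unique, since it is prescribed on the [X i]), and it
   has real dimension 2 ^ (p + q). *)
Definition one_vector_basis (R : realType) (K : scalarType R) (p q m : nat)
    (X : 'I_(p + q) -> 'M[K]_m) : Prop :=
  let A := generated_algebra X in
  [/\ clifford_relations X,
      has_real_dim A (2 ^ (p + q))%N &
      forall (B : algType R) (a : 'I_(p + q) -> B), clifford_relations a ->
        exists f : 'M[K]_m -> B,
        [/\ forall i, f (X i) = a i,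
            forall x y, A x -> A y -> f (x + y) = f x + f y,
            forall r x, A x -> f (rscale r x) = r *: f x &
            f 1 = 1 /\ forall x y, A x -> A y -> f (x * y) = f x * f y]].

Definition Ipq (R : realType) (p q : nat) : 'M[R]_(p + q) :=
  block_mx 1%:M 0 0 (- 1%:M).

Definition SO (R : realType) (p q : nat) : set 'M[R]_(p + q) :=
  [set X | X^T *m Ipq R p q *m X = Ipq R p q /\ \det X = 1].

Definition SO_plus (R : realType) (p q : nat) : set 'M[R]_(p + q) :=
  connected_component (@SO R p q) 1%:M.

(* Main.v *)
(* Existence, by induction on the rank of P - 1: if P <> 1, the symmetric matrix P
   has an eigenvector v = u + w of eigenvalue l <> 1, where u and w are the
   components of v in R^p and R^q.  As P I_{p,q} P = I_{p,q}, u - w is an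
   eigenvector of eigenvalue 1/l, so that |u| = |w| and we may normalize both to 1.
   With U = sum u_i V_i and W = sum w_i V_i, the boosts h = c + s U W
   (c^2 - s^2 = 1) are self-adjoint by (BP1), are joined to 1 inside the spin
   group, and Phi(h) is a hyperbolic rotation H of the plane (u, w).  A suitable h
   makes P' = H^-1 P H^-1 the identity on that plane, while P' fixes all the fixed
   vectors of P; if Y' lifts P' then Y = h Y' h is a positive definite lift of P.
   Uniqueness: if Y and Z are two lifts, then Z^cc Y is even and commutes with
   the generators, hence is a real number r, with r^2 = 1 and r > 0. *)
Require Import Defs.
From HB Require Import structures.
From mathcomp Require Import all_boot all_order all_algebra.
From mathcomp Require Import all_classical all_reals all_analysis.
From mathcomp Require Import ring lra complex.

Set Implicit Arguments.
Unset Strict Implicit.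
Unset Printing Implicit Defensive.

Import Order.TTheory GRing.Theory Num.Theory.
Import numFieldNormedType.Exports.

Local Open Scope classical_set_scope.
Local Open Scope ring_scope.

(** * Scalars and real matrix algebras *)

Lemma quat_eq (R : Type) (x y : quaternion R) :
  qr x = qr y -> qi x = qi y -> qj x = qj y -> qk x = qk y -> x = y.
Proof. by case: x y => ? ? ? ? [? ? ? ?] /= -> -> -> ->. Qed.

Section Scalars.
Variables (R : realType) (k : division_algebra).
Notation K := (scalars R k).
Implicit Types (r s : R) (x y : K).

Lemma srealD r s : sreal (r + s) = sreal r + sreal s :> K.
Proof.
case: k => //=.
  by apply/eqP; rewrite eq_complex /= addr0 !eqxx.
by apply: quat_eq; rewrite /= ?addr0.
Qed.

Lemma srealM r s : sreal (r * s) = sreal r * sreal s :> K.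
Proof.
case: k => //=.
  by apply/eqP; rewrite eq_complex /=; apply/andP; split; apply/eqP; ring.
by apply: quat_eq => /=; ring.
Qed.

Lemma sreal1 : sreal 1 = 1 :> K.
Proof. by case: k. Qed.

Lemma srealC r x : sreal r * x = x * sreal r.
Proof.
case: k x => //= x; [exact: mulrC|exact: mulrC|].
by apply: quat_eq => /=; ring.
Qed.

Lemma sreal_inj : injective (@sreal R K).
Proof. by case: k => // r s []. Qed.

Lemma sconjD x y : sconj (x + y) = sconj x + sconj y.
Proof.
case: k x y => //= [x y|x y]; first exact: raddfD.
by apply: quat_eq => /=; ring.
Qed.

Lemma sconjM x y : sconj (x * y) = sconj y * sconj x.
Proof.
case: k x y => //= [x y|x y|x y]; first exact: mulrC.
  by rewrite mulrC; exact: rmorphM.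
by apply: quat_eq => /=; ring.
Qed.

Lemma sconjK x : sconj (sconj x) = x.
Proof.
case: k x => //= [x|[a b c d]]; first exact: conjcK.
by apply: quat_eq => /=; rewrite ?opprK.
Qed.

Lemma sconj_real r : sconj (sreal r) = sreal r :> K.
Proof.
case: k => //=; first exact: conjc_real.
by apply: quat_eq => /=; rewrite ?oppr0.
Qed.

Lemma sconj_mul_ge0 x : exists2 r : R, 0 <= r & sconj x * x = sreal r.
Proof.
case: k x => [x|[a b]|[a b c d]].
- by exists (x * x) => //; rewrite -expr2 sqr_ge0.
- exists (a * a + b * b); first by rewrite -!expr2 addr_ge0 ?sqr_ge0.
  by apply/eqP; rewrite eq_complex /=; apply/andP; split; apply/eqP; ring.
- exists (a * a + b * b + c * c + d * d).
    by rewrite -!expr2 !addr_ge0 ?sqr_ge0.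
  by apply: quat_eq => /=; ring.
Qed.

Lemma sconj_mul_eq0 x : sconj x * x = 0 -> x = 0.
Proof.
case: k x => [x|[a b]|[a b c d]].
- by move/eqP; rewrite mulf_eq0 => /orP[] /eqP.
- move=> /eqP; rewrite eq_complex /= => /andP[/eqP h _].
  have ha := sqr_ge0 a; have hb := sqr_ge0 b.
  have /eqP : a ^+ 2 = 0 by lra.
  have /eqP : b ^+ 2 = 0 by lra.
  by rewrite !sqrf_eq0 => /eqP -> /eqP ->.
- case=> h _ _ _.
  have ha := sqr_ge0 a; have hb := sqr_ge0 b.
  have hc := sqr_ge0 c; have hd := sqr_ge0 d.
  have /eqP : a ^+ 2 = 0 by lra.
  have /eqP : b ^+ 2 = 0 by lra.
  have /eqP : c ^+ 2 = 0 by lra.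
  have /eqP : d ^+ 2 = 0 by lra.
  by rewrite !sqrf_eq0 => /eqP -> /eqP -> /eqP -> /eqP ->.
Qed.

Let sreal_zmod_morphism : zmod_morphism (@sreal R K).
Proof.
by move=> r s; apply: (addIr (sreal s)); rewrite -srealD !subrK.
Qed.
HB.instance Definition _ := GRing.isZmodMorphism.Build R K (@sreal R K)
  sreal_zmod_morphism.

End Scalars.

(* An alias, so that it carries the R-algebra structure rather than the
   K-module structure of 'M[K]. *)
Definition matalg (R : realType) (k : division_algebra) (m : nat) : Type :=
  'M[scalars R k]_m.+1.
HB.instance Definition _ R k m :=
  GRing.NzRing.copy (matalg R k m) ('M[scalars R k]_m.+1).

Section RealAlgebra.
Variables (R : realType) (k : division_algebra) (m : nat).
Local Notation B := (matalg R k m).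
Definition matalg_scale (r : R) (x : B) : B := rscale r (x : 'M[scalars R k]_m.+1).

Let matalg_scaleA (r s : R) (x : B) :
  matalg_scale r (matalg_scale s x) = matalg_scale (r * s) x.
Proof. by rewrite /matalg_scale /rscale scalerA srealM. Qed.
Let matalg_scale1 : left_id 1 matalg_scale.
Proof. by move=> x; rewrite /matalg_scale /rscale sreal1 scale1r. Qed.
Let matalg_scaleDr : right_distributive matalg_scale +%R.
Proof. by move=> r x y; exact: scalerDr. Qed.
Let matalg_scaleDl (x : B) : {morph matalg_scale^~ x : r s / r + s}.
Proof. by move=> r s; rewrite /matalg_scale /rscale srealD scalerDl. Qed.

HB.instance Definition _ := GRing.Zmodule_isLmodule.Build R B
  matalg_scaleA matalg_scale1 matalg_scaleDr matalg_scaleDl.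

Let matalg_scaleAl (r : R) (x y : B) : r *: (x * y) = (r *: x) * y.
Proof. exact: (@scalemxAl (scalars R k)). Qed.
HB.instance Definition _ := GRing.Lmodule_isLalgebra.Build R B matalg_scaleAl.

(** Real scalars are central in K, so they pass through a matrix product even over the
    quaternions. *)
Let matalg_scaleAr (r : R) (x y : B) : r *: (x * y) = x * (r *: y).
Proof.
apply/matrixP => i j; rewrite !mxE mulr_sumr; apply: eq_bigr => l _.
by rewrite !mxE !mulrA srealC.
Qed.
HB.instance Definition _ := GRing.Lalgebra_isAlgebra.Build R B matalg_scaleAr.

End RealAlgebra.

(** * Clifford relations and boosts in a real algebra *)

Section Clifford.
Variables (R : realType) (p q : nat) (B : algType R) (a : 'I_(p + q) -> B).
Local Notation n := (p + q)%N.
Implicit Types (u w : 'rV[R]_n) (i j : 'I_n) (s : seq 'I_n).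

(** Plays two roles: the square of a generator, and a diagonal entry of I_{p,q} ([IpqE]). *)
Definition signature i : R := if (i < p)%N then 1 else -1.

Lemma signatureM i : signature i * signature i = 1.
Proof. by rewrite /signature; case: ifP; rewrite ?mulrNN mulr1. Qed.

Definition one_vector u : B := \sum_i u 0 i *: a i.

Hypothesis relations : clifford_relations a.

Lemma clifford_sqr i : a i * a i = (signature i)%:A.
Proof.
rewrite relations.1 /signature; case: ifP => _; first by rewrite scale1r.
by rewrite scaleN1r.
Qed.

Lemma one_vector_anticommE u j :
  one_vector u * a j + a j * one_vector u = (2 * (u 0 j * signature j))%:A.
Proof.
rewrite /one_vector mulr_suml mulr_sumr -big_split (bigD1 j) //= big1 => [|i ij].
  rewrite -scalerAl -scalerAr clifford_sqr -mulr2n addr0 scalerA -scaler_nat.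
  by rewrite scalerA.
by rewrite -scalerAl -scalerAr -scalerDr relations.2 // addNr scaler0.
Qed.

Lemma one_vector_anticommE2 u w :
  one_vector u * one_vector w + one_vector w * one_vector u =
  (2 * \sum_i u 0 i * w 0 i * signature i)%:A.
Proof.
rewrite /one_vector mulr_suml !mulr_sumr -big_split scaler_suml.
apply: eq_bigr => i _ /=; rewrite -scalerAr -scalerAl -scalerDr -/(one_vector w).
rewrite addrC one_vector_anticommE.
by rewrite scalerA; congr (_ *: _); ring.
Qed.

(** The anticommutator with [a i] reads off the i-th coefficient, up to the factor 2 and a sign;
    freeness thus follows from the Clifford relations in any nonzero algebra. *)
Lemma one_vector_basis_free (c : 'I_n -> R) :
  \sum_i c i *: a i = 0 -> (1 : B) != 0 -> forall i, c i = 0.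
Proof.
move=> c0 B1 i; have := one_vector_anticommE (\row_i c i) i.
have -> : one_vector (\row_i c i) = 0.
  by rewrite -c0; apply: eq_bigr => j _; rewrite mxE.
rewrite mul0r mulr0 addr0 mxE => /esym/eqP; rewrite scaler_eq0 (negPf B1) orbF.
rewrite mulf_eq0 pnatr_eq0 /= /signature; case: ifP => _.
  by rewrite mulr1 => /eqP.
by rewrite mulrN1 oppr_eq0 => /eqP.
Qed.

(** Moving [a i] through the word gives one sign for each letter different from i. Their number is
    size minus count, which has the parity of size plus count. *)
Lemma conj_generator_word i s :
  a i * (\prod_(j <- s) a j) * a i =
  (signature i * (-1) ^+ (size s + count_mem i s))%:A * \prod_(j <- s) a j.
Proof.
elim: s => [|j s IHs] /=.
  by rewrite !big_nil mulr1 expr0 !mulr1 clifford_sqr.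
rewrite !big_cons; have [->|ij] := eqVneq j i.
  rewrite -!mulrA (mulrA _ _ (a i)) IHs -scalerAl mul1r -scalerAr -scalerAl mul1r.
  by congr (_ *: _); rewrite add1n addnS addSn !exprS !mulN1r opprK.
rewrite add0n addSn exprS mulN1r mulrN scaleNr mulNr -scalerAl mul1r.
rewrite mulrA relations.2 1?eq_sym // !mulNr; congr (- _).
by rewrite -!mulrA (mulrA _ _ (a i)) IHs -scalerAl mul1r -scalerAr.
Qed.

(** The first letter of a nonempty word of this kind occurs again later. By [conj_generator_word]
    the two occurrences can be removed at the cost of a sign, and the shorter word has the same
    parities. *)
Lemma even_word_scalar s :
  (forall i, ~~ odd (count_mem i s)) -> exists e : R, \prod_(i <- s) a i = e%:A.
Proof.
have [N] := ubnP (size s); elim: N s => // N IHN [|i s] /=.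
  by exists 1; rewrite big_nil scale1r.
rewrite ltnS => sN cnt; have : i \in s.
  rewrite -has_pred1 has_count.
  by have := cnt i; rewrite eqxx oddD /= negbK; case: count.
move=> s_i; case/splitPr: s_i sN cnt => s1 s2 sN cnt.
have [||e De] := IHN (s1 ++ s2).
- by move: sN; rewrite !size_cat /= addnS; apply: leq_trans; rewrite ltnS leqnSn.
- move=> j; have := cnt j; rewrite !count_cat /= !oddD !oddb.
  by case: (i == j); case: odd; case: odd.
exists (signature i * (-1) ^+ (size s1 + count_mem i s1) * e).
rewrite big_cons big_cat big_cons /= !mulrA conj_generator_word.
rewrite -[X in X = _]mulrA.
by rewrite -big_cat De -scalerAl mul1r scalerA.
Qed.

(* Since x = a_i x a_i^-1, the words containing a_i an odd number of times can be
   dropped from x, for each i in turn. *)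
Lemma even_center_scalar (d : nat) (c : 'I_d -> R) (s : 'I_d -> seq 'I_n) :
  (forall l, ~~ odd (size (s l))) ->
  let x := \sum_l c l *: \prod_(j <- s l) a j in
  (forall i, x * a i = a i * x) -> exists r : R, x = r%:A.
Proof.
move=> s_even x xC.
(* [L] lists the generators already treated: only the words in which each of them occurs an even
   number of times are left. *)
have sieve (L : seq 'I_n) : x = \sum_(l | all (fun i => ~~ odd (count_mem i (s l))) L)
    c l *: \prod_(j <- s l) a j.
  elim: L => [//|i L IHL] /=; have two0 : 2 != 0 :> R by rewrite pnatr_eq0.
  apply: (scalerI two0).
  have conjx : x = signature i *: (a i * x * a i).
    by rewrite -mulrA xC mulrA clifford_sqr -scalerAl mul1r scalerA signatureM scale1r.
  (* In 2x = x + sigma_i a_i x a_i the words are of even length, so those with an odd number of a_i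
     cancel and the others are doubled. *)
  rewrite scaler_nat mulr2n {2}conjx {1}IHL {1}IHL mulr_sumr mulr_suml scaler_sumr.
  rewrite -big_split scaler_sumr [RHS]big_mkcondl /=.
  rewrite [RHS]big_mkcond [LHS]big_mkcond; apply: eq_bigr => l _ /=.
  case: all => //.
  rewrite -scalerAr -scalerAl conj_generator_word -scalerAl mul1r !scalerA.
  rewrite mulrCA !mulrA mulrAC signatureM mul1r -scalerDl -signr_odd oddD.
  rewrite (negPf (s_even l)) /=; case: odd => /=; rewrite ?expr1 ?expr0.
    by rewrite mulN1r subrr scale0r.
  by rewrite mul1r mulr_natl mulr2n.
rewrite (sieve (enum 'I_n)).
pose good l := [forall i, ~~ odd (count_mem i (s l))].
(* The implication is put under the quantifier, with default value 0, so that [e] can be chosen for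
   all l at once. *)
have scal l : exists e : R, good l -> \prod_(j <- s l) a j = e%:A.
  case: (boolP (good l)) => [/forallP/even_word_scalar [e De]|_].
    by exists e.
  by exists 0.
have [e De] := choice scal; exists (\sum_(l | good l) c l * e l).
rewrite scaler_suml; apply: eq_big => [l|l /allP sl].
  by apply/allP/forallP => [h i|h i _]; apply: h; rewrite ?mem_enum.
by rewrite De ?scalerA //; apply/forallP => i; apply: sl; rewrite mem_enum.
Qed.

End Clifford.

(** * Boosts generated by a bivector U W of square 1 *)

Section Boost.
Variables (R : realType) (B : algType R) (U W : B).
Hypotheses (UU : U * U = 1) (WW : W * W = - 1) (WU : W * U = - (U * W)).

(** For c = cosh t and s = sinh t this is exp(t U W), because (U W)^2 = 1; the inverse is obtained
    by changing the sign of s. *)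
Definition boost (c s : R) : B := c%:A + s *: (U * W).

Lemma boost_bivector_sqr : U * W * (U * W) = 1.
Proof. by rewrite mulrA -(mulrA U) WU mulrN mulrA UU mul1r mulNr WW opprK. Qed.

Lemma boostV c s : c ^+ 2 - s ^+ 2 = 1 -> boost c s * boost c (- s) = 1.
Proof.
move=> cs; rewrite /boost mulrDl !mulrDr -!scalerAl -!scalerAr boost_bivector_sqr.
rewrite !mul1r !mulr1 !scalerA -addrA [X in _ + X]addrA -scalerDl.
rewrite mulrN [c * s]mulrC addNr scale0r add0r -scalerDl mulrN -!expr2 cs.
by rewrite scale1r.
Qed.

(** The two anticommutators say that alpha U + beta W is the component of v in the plane (U, W).
    That component undergoes a hyperbolic rotation by the double angle, cosh 2t = 1 + 2 s^2 and sinh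
    2t = 2 c s. *)
Lemma boost_conj (c s alpha beta : R) v : c ^+ 2 - s ^+ 2 = 1 ->
  U * v + v * U = (2 * alpha)%:A -> W * v + v * W = (- (2 * beta))%:A ->
  boost c s * v * boost c (- s) =
  v - (2 * (c * s)) *: (beta *: U + alpha *: W)
    + (2 * s ^+ 2) *: (alpha *: U + beta *: W).
Proof.
move=> cs Uv Wv; set X := beta *: U + alpha *: W.
(* The commutator of U W with v, expressed by the anticommutators of v with U and with W. *)
have UWv : U * W * v = v * (U * W) - 2 *: X.
  have -> : U * W * v = U * (W * v + v * W) - (U * v + v * U) * W + v * (U * W).
    by rewrite mulrDr mulrDl !mulrA opprD addrA addrK subrK.
  rewrite Uv Wv -scalerAr -scalerAl mulr1 mul1r addrC scaleNr -opprD.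
  by rewrite /X scalerDr !scalerA.
have [t Dt] : exists t, t = 2 * s by exists (2 * s).
have -> : boost c s * v = v * boost c s - t *: X.
  rewrite /boost mulrDl mulrDr -!scalerAl -!scalerAr mul1r mulr1 UWv scalerBr.
  by rewrite scalerA addrA [s * 2]mulrC -Dt.
rewrite mulrBl -mulrA boostV // mulr1 -addrA; congr (_ + _).
have UN : U * (U * W) = W by rewrite mulrA UU mul1r.
have WN : W * (U * W) = U by rewrite mulrA WU mulNr -mulrA WW mulrN1 opprK.
have XN : X * (U * W) = alpha *: U + beta *: W.
  by rewrite /X mulrDl -!scalerAl UN WN addrC.
have XB : X * boost c (- s) = c *: X - s *: (alpha *: U + beta *: W).
  by rewrite /boost mulrDr -!scalerAr mulr1 XN scaleNr.
rewrite -scalerAl XB scalerBr opprB addrC !scalerA Dt -!mulrA -expr2.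
by rewrite [s * c]mulrC.
Qed.

End Boost.

Section BoostOneVector.
Variables (R : realType) (p q : nat) (B : algType R) (a : 'I_(p + q) -> B).
Local Notation n := (p + q)%N.
Hypothesis relations : clifford_relations a.

(** For orthonormal u, w and c^2 - s^2 = 1, the hyperbolic rotation of the plane (u, w) that fixes
    its orthogonal complement. *)
Definition boost_mx (u w : 'rV[R]_n) (c s : R) : 'M[R]_n :=
  1%:M - (2 * (c * s)) *: (u^T *m w + w^T *m u)
    + (2 * s ^+ 2) *: (u^T *m u + w^T *m w).

Variables u w : 'rV[R]_n.
(** These equations say that u is supported on the first p coordinates and w on the last q; they are
    the entries of u J = u and w J = - w for J = I_{p,q}. *)
Hypotheses (u_space : forall i, u 0 i * signature R i = u 0 i)
  (w_time : forall i, w 0 i * signature R i = - w 0 i).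
Hypotheses (u1 : \sum_i u 0 i ^+ 2 = 1) (w1 : \sum_i w 0 i ^+ 2 = 1).
Local Notation U := (one_vector a u).
Local Notation W := (one_vector a w).

Let half (x y : B) : x + x = y + y -> x = y.
Proof.
have two0 : 2 != 0 :> R by rewrite pnatr_eq0.
by move=> xy; apply: (scalerI two0); rewrite !scaler_nat !mulr2n.
Qed.

Lemma space_vector_sqr : U * U = 1.
Proof.
apply: half; rewrite one_vector_anticommE2 //.
under eq_bigr => i _ do rewrite -mulrA u_space -expr2.
by rewrite u1 mulr1 scaler_nat mulr2n.
Qed.

Lemma time_vector_sqr : W * W = - 1.
Proof.
apply: half; rewrite one_vector_anticommE2 //.
under eq_bigr => i _ do rewrite -mulrA w_time mulrN -expr2.
by rewrite sumrN w1 mulrN mulr1 scaleNr scaler_nat mulr2n opprD.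
Qed.

Lemma time_space_disjoint i : w 0 i * u 0 i = 0.
Proof.
have: w 0 i * u 0 i = - (w 0 i * u 0 i).
  by rewrite -[in LHS]u_space mulrCA w_time mulrN mulrC.
lra.
Qed.

Lemma time_space_anticomm : W * U = - (U * W).
Proof.
apply/eqP; rewrite -addr_eq0 one_vector_anticommE2 // big1 => [|i _].
  by rewrite mulr0 scale0r.
by rewrite time_space_disjoint mul0r.
Qed.

Lemma boost_generator c s j : c ^+ 2 - s ^+ 2 = 1 ->
  boost U W c s * a j * boost U W c (- s) =
  \sum_i boost_mx u w c s i j *: a i.
Proof.
move=> cs.
have [UU WW WU] := And3 space_vector_sqr time_vector_sqr time_space_anticomm.
rewrite (boost_conj UU WW WU (alpha := u 0 j) (beta := w 0 j)) //; last 2 first.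
- by rewrite one_vector_anticommE // u_space.
- by rewrite one_vector_anticommE // w_time mulrN.
have -> : a j = \sum_i (i == j)%:R *: a i.
  rewrite (bigD1 j) //= eqxx scale1r big1 ?addr0 // => i /negPf ->.
  by rewrite scale0r.
rewrite /one_vector !scaler_sumr -!big_split !scaler_sumr -sumrN -!big_split /=.
apply: eq_bigr => i _; rewrite !mxE !big_ord1 !mxE !scalerA -!scalerDl !scalerA.
rewrite -scaleNr -!scalerDl; congr (_ *: _); ring.
Qed.

End BoostOneVector.

(** * Positive definite matrices *)

Section Adjoint.
Variables (R : realType) (k : division_algebra).
Local Notation K := (scalars R k).

Lemma adjmxM (m n l : nat) (X : 'M[K]_(m, n)) (Y : 'M[K]_(n, l)) :
  adjmx (X *m Y) = adjmx Y *m adjmx X.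
Proof.
have sconj_sum (I : finType) (F : I -> K) : sconj (\sum_i F i) = \sum_i sconj (F i).
  apply: (big_morph (@sconj R K)); first exact: sconjD.
  by rewrite -(raddf0 (@sreal R K)) sconj_real.
apply/matrixP => i j; rewrite !mxE sconj_sum; apply: eq_bigr => h _.
by rewrite !mxE sconjM.
Qed.

Lemma adjmxK (m n : nat) (X : 'M[K]_(m, n)) : adjmx (adjmx X) = X.
Proof. by apply/matrixP => i j; rewrite !mxE sconjK. Qed.

Lemma adjmxD (m n : nat) (X Y : 'M[K]_(m, n)) :
  adjmx (X + Y) = adjmx X + adjmx Y.
Proof. by apply/matrixP => i j; rewrite !mxE sconjD. Qed.

Lemma adjmx_rscale (m : nat) r (X : 'M[K]_m) :
  adjmx (rscale r X) = rscale r (adjmx X).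
Proof. by apply/matrixP => i j; rewrite !mxE sconjM sconj_real srealC. Qed.

Lemma adjmx1 (m : nat) : adjmx 1%:M = 1%:M :> 'M[K]_m.
Proof.
apply/matrixP => i j; rewrite !mxE eq_sym.
case: eqP => _ /=; first by rewrite mulr1n -sreal1 sconj_real.
by rewrite mulr0n -(raddf0 (@sreal R K)) sconj_real.
Qed.

Lemma adjmx_mul_self (m : nat) (v : 'cV[K]_m) :
  exists r : R, [/\ 0 <= r, (adjmx v *m v) 0 0 = sreal r & r = 0 -> v = 0].
Proof.
have /choice [r rP] (i : 'I_m) : exists r : R,
    [/\ 0 <= r, sconj (v i 0) * v i 0 = sreal r & r = 0 -> v i 0 = 0].
  have [r r0 vr] := sconj_mul_ge0 (v i 0).
  by exists r; split=> // rz; apply: sconj_mul_eq0; rewrite vr rz raddf0.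
exists (\sum_i r i); split.
- by apply: sumr_ge0 => i _; case: (rP i).
- rewrite !mxE raddf_sum; apply: eq_bigr => i _.
  by rewrite !mxE; case: (rP i).
- move=> /psumr_eq0P r0; apply/matrixP => i j; rewrite ord1 mxE.
  by case: (rP i) => _ _; apply; apply: r0 => // l _; case: (rP l).
Qed.

Lemma posdef1 (m : nat) : posdef (1%:M : 'M[K]_m).
Proof.
split=> [|v v0]; first exact: adjmx1.
have [r [r_ge0 vr r0]] := adjmx_mul_self v; rewrite mulmx1; exists r => //.
rewrite lt_neqAle r_ge0 andbT eq_sym; apply/eqP => rz.
by rewrite r0 ?eqxx in v0.
Qed.

(** The kernel condition expresses injectivity of [h] without determinants, uniformly over R, C and
    H. *)
Lemma posdef_congr (m : nat) (Y h : 'M[K]_m) :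
  posdef Y -> (forall v : 'cV_m, h *m v = 0 -> v = 0) ->
  posdef (adjmx h *m Y *m h).
Proof.
move=> [Ys Yp] h0; split=> [|v v0].
  by rewrite !adjmxM adjmxK Ys mulmxA.
have [|r r0 hr] := Yp (h *m v); first by apply: contra_neq v0 => /h0.
by exists r => //; rewrite -hr adjmxM !mulmxA.
Qed.

Lemma posdef_ker (m : nat) (Y : 'M[K]_m) (v : 'cV_m) :
  posdef Y -> Y *m v = 0 -> v = 0.
Proof.
move=> [_ Yp] Yv; apply: contrapT => /eqP /Yp [r].
rewrite -mulmxA Yv mulmx0 mxE => r0; rewrite -(raddf0 (@sreal R K)).
by move=> /sreal_inj r00; rewrite -r00 ltxx in r0.
Qed.

(** Evaluating both forms at one nonzero vector gives positive reals s and r s; the real r is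
    central, so it can be pulled out in front of v^*. *)
Lemma posdef_scale_gt0 (m : nat) (Y : 'M[K]_m.+1) (r : R) :
  posdef Y -> posdef (rscale r Y) -> 0 < r.
Proof.
pose v : 'cV[K]_m.+1 := delta_mx 0 0.
have v0 : v != 0.
  apply/eqP => /matrixP /(_ 0 0) /eqP; rewrite !mxE !eqxx.
  by rewrite -sreal1 -(raddf0 (@sreal R K)) => /eqP /sreal_inj /eqP; rewrite oner_eq0.
move=> [_ /(_ v v0) [s s0 Ys]] [_ /(_ v v0) [t t0]].
have -> : rscale r Y = (sreal r)%:M *m Y by rewrite mul_scalar_mx.
have -> : adjmx v *m ((sreal r)%:M *m Y) *m v = (sreal r)%:M *m (adjmx v *m Y *m v).
  rewrite !mulmxA; congr (_ *m _ *m _); apply/matrixP => i j.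
  by rewrite mul_scalar_mx -diag_const_mx mul_mx_diag !mxE srealC.
rewrite mul_scalar_mx mxE Ys -srealM => /sreal_inj rs.
by rewrite -(pmulr_lgt0 _ s0) rs.
Qed.

(** Otherwise - v^* v = (X v)^* (X v) would be nonnegative for a nonzero v. This excludes the wrong
    sign in V_i^* = +- V_i. *)
Lemma adjmx_mul_selfN1 (m : nat) (X : 'M[K]_m.+1) : adjmx X *m X <> - 1%:M.
Proof.
pose v : 'cV[K]_m.+1 := delta_mx 0 0.
move=> XN; have [r [r0 rE _]] := adjmx_mul_self (X *m v).
have [_ /(_ v)[|s s0 sE]] := posdef1 m.+1.
  apply/eqP => /matrixP /(_ 0 0) /eqP; rewrite !mxE !eqxx.
  by rewrite -sreal1 -(raddf0 (@sreal R K)) => /eqP /sreal_inj /eqP; rewrite oner_eq0.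
move: rE; rewrite adjmxM mulmxA -(mulmxA _ _ X) XN mulmxN mulNmx mxE sE.
by rewrite -raddfN => /sreal_inj rs; move: r0; rewrite -rs oppr_ge0 leNgt s0.
Qed.

End Adjoint.

(** * Clifford conjugation and the spin group *)

Section RealSpan.
Variables (R : realType) (k : division_algebra) (m : nat).
Local Notation B := (matalg R k m).
Implicit Types (A : set B) (x y : B).

Lemma real_span_ind A (Q : B -> Prop) :
  Q 0 -> (forall x y, Q x -> Q y -> Q (x + y)) ->
  (forall r x, A x -> Q (r *: x)) -> forall x, real_span A x -> Q x.
Proof.
move=> Q0 QD QZ x [d [c [b [Ab ->]]]].
by elim/big_ind: _ => // i _; apply: QZ.
Qed.

Lemma mem_real_span A r x : A x -> real_span A (r *: x).
Proof. by move=> Ax; exists 1, (fun=> r), (fun=> x); rewrite big_ord1. Qed.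

Lemma real_span_id A x : A x -> real_span A x.
Proof. by move=> Ax; rewrite -[x]scale1r; exact: mem_real_span. Qed.

Lemma real_span0 A : real_span A (0 : B).
Proof.
exists 0, (fun=> 0), (fun=> 0); rewrite big_ord0; split=> //.
by case.
Qed.

Lemma real_spanD A x y : real_span A x -> real_span A y -> real_span A (x + y).
Proof.
move=> [d [c [b [Ab ->]]]] [d' [c' [b' [Ab' ->]]]].
pose glue T (f : 'I_d -> T) (g : 'I_d' -> T) i :=
  match fintype.split i with inl j => f j | inr j => g j end.
exists (d + d')%N, (glue _ c c'), (glue _ b b'); split.
  by move=> i; rewrite /glue; case: fintype.split.
rewrite big_split_ord /=; congr (_ + _); apply: eq_bigr => i _.
  by rewrite /glue -[lshift _ _]/(unsplit (inl i)) unsplitK.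
by rewrite /glue -[rshift _ _]/(unsplit (inr i)) unsplitK.
Qed.

Lemma real_spanZ A r x : real_span A x -> real_span A (r *: x).
Proof.
move: x; apply: real_span_ind => [|x y|s x Ax].
- by rewrite scaler0; exact: real_span0.
- by rewrite scalerDr; exact: real_spanD.
- by rewrite scalerA; exact: mem_real_span.
Qed.

Lemma real_span_sum A (I : finType) (F : I -> B) :
  (forall i, real_span A (F i)) -> real_span A (\sum_i F i).
Proof.
move=> AF; elim/big_ind: _ => //; [exact: real_span0|exact: real_spanD].
Qed.

Lemma real_spanM A : (forall x y, A x -> A y -> A (x * y)) ->
  forall x y, real_span A x -> real_span A y -> real_span A (x * y).
Proof.
move=> AM x y Ax Ay; move: x Ax; apply: real_span_ind => [|x x'|r x Ax].
- by rewrite mul0r; exact: real_span0.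
- by rewrite mulrDl; exact: real_spanD.
rewrite -scalerAl; apply: real_spanZ.
move: y Ay; apply: real_span_ind => [|y y'|s y Ay].
- by rewrite mulr0; exact: real_span0.
- by rewrite mulrDr; exact: real_spanD.
by rewrite -scalerAr; apply: mem_real_span; exact: AM.
Qed.

(** A combination in [real_span] may use the same [V i] several times; here the coefficients are
    collected by index. *)
Lemma real_span_range n (V : 'I_n -> B) x : real_span (range V) x ->
  exists c : 'I_n -> R, x = \sum_i c i *: V i.
Proof.
move: x; apply: real_span_ind => [|x y [c ->] [c' ->]|r _ [i _ <-]].
- by exists (fun=> 0); rewrite big1 // => i _; rewrite scale0r.
- exists (fun i => c i + c' i); rewrite -big_split; apply: eq_bigr => i _.
  by rewrite scalerDl.
- exists (fun j => r * (j == i)%:R); rewrite (bigD1 i) //= eqxx mulr1 big1 ?addr0 //.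
  by move=> j /negPf ->; rewrite mulr0 scale0r.
Qed.

End RealSpan.

(** * The generated algebra, its even part and its Clifford conjugation *)

Section Conjugation.
Variables (R : realType) (k : division_algebra) (m n : nat).
Local Notation B := (matalg R k m).
Variable V : 'I_n -> B.
Local Notation alg := (@generated_algebra R (scalars R k) n m.+1 V).
Local Notation even := (@even_elements R (scalars R k) n m.+1 V).

Lemma wordE s : word V s = \prod_(i <- s) V i :> B.
Proof. by []. Qed.

Lemma word_cat s t : word V (s ++ t) = (word V s : B) * word V t.
Proof. by rewrite !wordE big_cat. Qed.

Lemma alg_word s : alg (word V s).
Proof. by apply: real_span_id; exists s. Qed.

Lemma alg_generator i : alg (V i).
Proof. by have := alg_word [:: i]; rewrite wordE big_seq1. Qed.

Lemma alg1 : alg (1 : B).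
Proof. by have := alg_word [::]; rewrite wordE big_nil. Qed.

Lemma algM (x y : B) : alg x -> alg y -> alg (x * y).
Proof.
apply: real_spanM => _ _ [s _ <-] [t _ <-].
by exists (s ++ t) => //; rewrite word_cat.
Qed.

Lemma even_alg x : even x -> alg x.
Proof.
move: x; apply: real_span_ind => [|x y|r _ [s _ <-]]; first exact: real_span0.
  exact: real_spanD.
by apply: mem_real_span; exists s.
Qed.

Lemma even1 : even (1 : B).
Proof. by apply: real_span_id; exists [::]; rewrite ?wordE ?big_nil. Qed.

Lemma evenM (x y : B) : even x -> even y -> even (x * y).
Proof.
apply: real_spanM => _ _ [s s_even <-] [t t_even <-].
exists (s ++ t); last by rewrite word_cat.
by rewrite /= size_cat oddD; move: s_even t_even => /= /negPf -> /negPf ->.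
Qed.

Lemma even_generatorM i j : even (V i * V j).
Proof.
apply: real_span_id; exists [:: i; j] => //.
by rewrite wordE big_cons big_seq1.
Qed.

Lemma clifford_conjugation_unique f g x :
  clifford_conjugation V f -> clifford_conjugation V g -> alg x -> f x = g x.
Proof.
have conj0 h : clifford_conjugation V h -> h (0 : B) = 0.
  case=> _ _ hD _ _; apply: (addrI (h (0 : B))).
  by rewrite -hD ?addr0 //; exact: real_span0.
move=> Cf Cg Ax.
(* Membership is carried through the induction because f and g are additive only on the algebra. *)
suff [] : alg x /\ f x = g x by [].
move: x Ax; apply: real_span_ind => [|x y [Ax fx] [Ay fy]|r _ [s _ <-]].
- by split; [exact: real_span0|rewrite !conj0].
- split; first exact: real_spanD.
  by case: Cf Cg => [_ _ fD _ _] [_ _ gD _ _]; rewrite fD // gD // fx fy.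
split; first by apply: mem_real_span; exists s.
case: Cf Cg => [_ fV fD fZ [f1 fM]] [_ gV gD gZ [g1 gM]].
rewrite fZ ?gZ; [|exact: alg_word..]; congr rscale.
elim: s => [|i s IHs]; first by rewrite !wordE !big_nil f1 g1.
have -> : word V (i :: s) = (V i : B) * word V s by rewrite /word big_cons.
rewrite fM ?gM ?IHs ?fV ?gV //; by [exact: alg_word|exact: alg_generator].
Qed.

(** [cc] chooses its values point by point; by uniqueness all candidates agree on the algebra, so
    there [cc] coincides with any given conjugation and inherits its properties. *)
Lemma cc_conjugation : (exists f, clifford_conjugation V f) ->
  clifford_conjugation V (cc V).
Proof.
move=> [f Cf].
have ccE x : alg x -> cc V x = f x.
  move=> Ax; rewrite /cc; case: xgetP => [y _ [g Cg ->]|/(_ (f x))[]].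
    exact: clifford_conjugation_unique.
  by exists f.
case: (Cf) => [[ff fi fs] fV fD fZ [f1 fM]]; split.
- split.
  + by move=> x Ax; rewrite ccE //; exact: ff.
  + move=> x y xA yA; rewrite !ccE; [exact: fi|exact: set_mem..].
  + by move=> y /fs [x Ax <-]; exists x => //; rewrite ccE.
- by move=> i; rewrite ccE //; exact: alg_generator.
- by move=> x y Ax Ay; rewrite !ccE ?fD //; exact: real_spanD.
- by move=> r x Ax; rewrite !ccE ?fZ //; exact: real_spanZ.
- split; first by rewrite ccE //; exact: alg1.
  by move=> x y Ax Ay; rewrite !ccE ?fM //; exact: algM.
Qed.

End Conjugation.

(** * The spin group and its action on one-vectors *)

Section SpinGroup.
Variables (R : realType) (k : division_algebra) (m p q : nat).
Local Notation B := (matalg R k m).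
Local Notation n := (p + q)%N.
Variable V : 'I_n -> B.
Local Notation alg := (@generated_algebra R (scalars R k) n m.+1 V).
Local Notation even := (@even_elements R (scalars R k) n m.+1 V).
Hypothesis basisV : @one_vector_basis R (scalars R k) p q m.+1 V.
Hypothesis adjV : forall i, @adjmx R (scalars R k) _ _ (V i) = V i \/
  @adjmx R (scalars R k) _ _ (V i) = - V i.

Lemma one_vector_basis_relations : clifford_relations V.
Proof. by case: basisV. Qed.
Let relV := one_vector_basis_relations.

Definition adj (x : B) : B := adjmx (x : 'M[scalars R k]_m.+1).

Lemma adjD x y : adj (x + y) = adj x + adj y.
Proof. exact: adjmxD. Qed.

Lemma adjZ r x : adj (r *: x) = r *: adj x.
Proof. exact: adjmx_rscale. Qed.

Lemma adjM x y : adj (x * y) = adj y * adj x.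
Proof. exact: adjmxM. Qed.

Lemma adj1 : adj 1 = 1.
Proof. exact: adjmx1. Qed.

(** If V_i^* = e V_i then V_i^* V_i = e sigma_i, which cannot be -1; hence e = sigma_i. *)
Lemma adj_generator i : adj (V i) = signature R i *: V i.
Proof.
have := clifford_sqr relV i; have := adjV i; rewrite /signature.
case: ifP => _ [] VE VV.
- by rewrite scale1r.
- rewrite scale1r in VV; case: (@adjmx_mul_selfN1 R k m (V i)).
  by rewrite VE mulNmx; congr (- _).
- rewrite scaleN1r in VV; case: (@adjmx_mul_selfN1 R k m (V i)).
  by rewrite VE.
- by rewrite scaleN1r.
Qed.

(** Applied with c = 1 to vectors of R^p and with c = -1 to vectors of R^q. *)
Lemma adj_one_vector (c : R) (u : 'rV[R]_n) :
  (forall i, u 0 i * signature R i = c * u 0 i) ->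
  adj (one_vector V u) = c *: one_vector V u.
Proof.
move=> uc; rewrite /one_vector scaler_sumr (big_morph adj adjD (_ : adj 0 = 0)).
  by apply: eq_bigr => i _; rewrite adjZ adj_generator !scalerA uc.
by rewrite -[0 in LHS](scale0r 1) adjZ scale0r.
Qed.

(* By adj_generator, the adjoint is an anti-automorphism mapping V_i to
   sigma_i V_i, where sigma_i = V_i^2; it is composed with the automorphism
   V_i |-> - sigma_i V_i given by universality. *)
Lemma clifford_conjugation_exists :
  exists f, @clifford_conjugation R (scalars R k) n m.+1 V f.
Proof.
have [_ _ univ] := basisV.
pose a i : B := - signature R i *: V i.
have aV i : a i * a i = V i * V i.
  by rewrite /a -scalerAl -scalerAr scalerA mulrNN signatureM scale1r.
have relA : clifford_relations a.
  split=> [i|i j ij]; first by rewrite aV relV.1.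
  by rewrite /a -!scalerAl -!scalerAr relV.2 // !scalerN !scalerA mulrC.
have [f [fV fD fZ [f1 fM]]] := univ B a relA.
have {}fZ r (x : B) : alg x -> f (r *: x) = r *: f x by exact: fZ.
have {}fD (x y : B) : alg x -> alg y -> f (x + y) = f x + f y by exact: fD.
have {}fM (x y : B) : alg x -> alg y -> f (x * y) = f x * f y by exact: fM.
pose g (x : B) : B := adj (f x).
have gV i : g (V i) = - V i.
  rewrite /g fV /a adjZ adj_generator scalerA mulNr signatureM.
  by rewrite scaleN1r.
have gD (x y : B) : alg x -> alg y -> g (x + y) = g x + g y.
  by move=> Ax Ay; rewrite /g fD // adjD.
have gZ r (x : B) : alg x -> g (r *: x) = r *: g x.
  by move=> Ax; rewrite /g fZ // adjZ.
have g1 : g 1 = 1 by rewrite /g f1 adj1.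
have gM (x y : B) : alg x -> alg y -> g (x * y) = g y * g x.
  by move=> Ax Ay; rewrite /g fM // adjM.
have A0 : alg 0 by exact: real_span0.
have g0 : g 0 = 0 by rewrite -[0 in LHS](scale0r 0) gZ // scale0r.
have algN i : alg (- V i).
  by rewrite -scaleN1r; apply: real_spanZ; exact: alg_generator.
(* [g] is an involution of the algebra, whence the bijectivity asked of a Clifford conjugation. *)
have gK (x : B) : alg x -> alg (g x) /\ g (g x) = x.
  move=> Ax; suff [] : alg x /\ (alg (g x) /\ g (g x) = x) by [].
  move: x Ax; apply: real_span_ind => [|x y [Ax [Agx gx]] [Ay [Agy gy]]|].
  - by rewrite !g0.
  - by rewrite !gD // gx gy; do !split=> //; exact: real_spanD.
  move=> r _ [s _ <-]; split; first by apply: mem_real_span; exists s.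
  suff [Ags gs] : alg (g (word V s)) /\ g (g (word V s)) = word V s.
    rewrite !gZ ?gs //; last exact: alg_word.
    by split=> //; exact: real_spanZ.
  elim: s => [|i s [Ags gs]].
    by rewrite wordE big_nil !g1; split=> //; exact: alg1.
  have -> : word V (i :: s) = (V i : B) * word V s by rewrite /word big_cons.
  rewrite gM ?gV; [|exact: alg_generator|exact: alg_word].
  split; first exact: algM.
  rewrite gM // gs -[- V i]scaleN1r gZ ?gV ?scaleN1r ?opprK //.
  exact: alg_generator.
exists g; split=> //; split.
- by move=> x /gK [].
- by move=> x y /set_mem /gK [_ gx] /set_mem /gK [_ gy] /(congr1 g); rewrite gx gy.
- by move=> x /gK [Agx gx]; exists (g x).
Qed.

Definition conj : B -> B := @cc R (scalars R k) n m.+1 V.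

Let ccV := cc_conjugation clifford_conjugation_exists.

Lemma conj_generator i : conj (V i) = - V i.
Proof. by case: ccV. Qed.

Lemma conjD (x y : B) : alg x -> alg y -> conj (x + y) = conj x + conj y.
Proof. by case: ccV => _ _ fD _ _; exact: fD. Qed.

Lemma conjZ r (x : B) : alg x -> conj (r *: x) = r *: conj x.
Proof. by case: ccV => _ _ _ fZ _; exact: fZ. Qed.

Lemma conjM (x y : B) : alg x -> alg y -> conj (x * y) = conj y * conj x.
Proof. by case: ccV => _ _ _ _ [_ fM]; exact: fM. Qed.

Lemma conj1 : conj 1 = 1.
Proof. by case: ccV => _ _ _ _ []. Qed.

Lemma conj_one_vector u : alg (one_vector V u) /\
  conj (one_vector V u) = - one_vector V u.
Proof.
rewrite /one_vector; elim/big_ind: _ => [|x y [Ax cx] [Ay cy]|i _].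
- split; first exact: real_span0.
  by rewrite -[0 in LHS](scale0r 0) conjZ ?scale0r ?oppr0 //; exact: real_span0.
- by split; [exact: real_spanD|rewrite conjD // cx cy opprD].
- split; first by apply: real_spanZ; exact: alg_generator.
  by rewrite conjZ ?conj_generator ?scalerN //; exact: alg_generator.
Qed.

(** Clifford conjugation reverses a word up to sign and so keeps its length. *)
Lemma even_conj (x : B) : even x -> even (conj x).
Proof.
have conj_word s : conj (word V s) = (-1) ^+ size s *: (word V (rev s) : B).
  elim: s => [|i s IHs].
    by rewrite wordE big_nil conj1 expr0 scale1r.
  have -> : word V (i :: s) = (V i : B) * word V s by rewrite /word big_cons.
  rewrite conjM ?conj_generator ?IHs; [|exact: alg_generator|exact: alg_word].
  rewrite mulrN -scalerAl -scaleNr exprS mulN1r rev_cons; congr (_ *: _).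
  by rewrite !wordE -cats1 big_cat big_seq1.
move=> x_even; suff [] : alg x /\ even (conj x) by [].
move: x x_even; apply: real_span_ind => [|x y [Ax cx] [Ay cy]|r _ [s s_even <-]].
- split; first exact: real_span0.
  have -> : conj 0 = 0; last exact: real_span0.
  by rewrite -[0 in LHS](scale0r 0) conjZ ?scale0r //; exact: real_span0.
- by split; [exact: real_spanD|rewrite conjD //; exact: real_spanD].
- split; first by apply: mem_real_span; exists s.
  rewrite conjZ ?conj_word ?scalerA; last exact: alg_word.
  by apply: mem_real_span; exists (rev s) => //=; rewrite size_rev.
Qed.

(** The relation behind [Phi]. It composes without any choice and itself shows that x preserves
    one-vectors. *)
Definition acts (x : B) (M : 'M[R]_n) :=
  forall j, x * V j * conj x = \sum_i M i j *: V i.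

Lemma acts1 : acts 1 1%:M.
Proof.
move=> j; rewrite conj1 mul1r mulr1 (bigD1 j) //= mxE eqxx scale1r.
by rewrite big1 ?addr0 // => i /negPf ij; rewrite mxE ij scale0r.
Qed.

Lemma actsM (x y : B) M N : alg x -> alg y -> acts x M -> acts y N ->
  acts (x * y) (M *m N).
Proof.
move=> Ax Ay xM yN j; rewrite conjM // -!mulrA (mulrA y) (mulrA (y * _)) yN.
rewrite mulr_suml mulr_sumr.
under eq_bigr => i _ do
  rewrite -scalerAl -scalerAr mulrA xM scaler_sumr.
rewrite exchange_big; apply: eq_bigr => i _ /=; rewrite mxE scaler_suml.
by apply: eq_bigr => l _; rewrite scalerA mulrC.
Qed.

Lemma acts_inj x M N : acts x M -> acts x N -> M = N.
Proof.
move=> xM xN; apply/matrixP => i j; apply/eqP; rewrite -subr_eq0; apply/eqP.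
suff /(one_vector_basis_free relV)/(_ (oner_neq0 B) i) :
  \sum_i (M i j - N i j) *: V i = 0 by [].
under eq_bigr => l _ do rewrite scalerBl.
by rewrite sumrB -xM -xN subrr.
Qed.

Lemma spin_groupP (x : B) M : even x -> x * conj x = 1 -> acts x M ->
  @spin_group R (scalars R k) n m.+1 V x.
Proof.
move=> x_even x1 xM; split=> // v /real_span_range [c ->].
change (real_span (range V) (x * (\sum_i c i *: V i) * conj x)).
rewrite mulr_sumr mulr_suml; apply: real_span_sum => i.
rewrite -scalerAr -scalerAl xM; apply: real_spanZ; apply: real_span_sum => j.
by apply: mem_real_span; exists j.
Qed.

Lemma Phi_acts (x : B) M : acts x M -> @Phi R (scalars R k) n m.+1 V x = M.
Proof.
move=> xM; rewrite /Phi; case: xgetP => [N _ xN|/(_ M)[]]; last exact: xM.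
exact: (acts_inj (xN : acts x N)).
Qed.

Lemma spin_acts (x : B) : @spin_group R (scalars R k) n m.+1 V x ->
  acts x (@Phi R (scalars R k) n m.+1 V x).
Proof.
move=> [_ _ xV].
have /choice [c cP] j : exists c : 'I_n -> R, x * V j * conj x = \sum_i c i *: V i.
  by apply: real_span_range; apply: xV; apply: real_span_id; exists j.
have xM : acts x (\matrix_(i, j) c j i).
  by move=> j; rewrite cP; apply: eq_bigr => i _; rewrite mxE.
by rewrite (Phi_acts xM).
Qed.

Lemma even_central_scalar (x : B) : even x -> (forall i, x * V i = V i * x) ->
  exists r : R, x = r%:A.
Proof.
move=> [d [c [b [bE ->]]]] xC.
have /choice [s sP] l : exists s : seq 'I_n,
    ~~ odd (size s) /\ b l = \prod_(i <- s) V i.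
  by have [s s_even <-] := bE l; exists s.
have xE : \sum_l rscale (c l) (b l) = \sum_l c l *: (\prod_(i <- s l) V i : B).
  by apply: eq_bigr => l _; rewrite (sP l).2.
rewrite xE in xC *; apply: (even_center_scalar relV) xC => l.
exact: (sP l).1.
Qed.

(** A positive definite x is injective and x (x^cc x - 1) = 0, so every column of x^cc x - 1
    vanishes. *)
Lemma posdef_spin_conjV (x : B) : posdef x -> x * conj x = 1 -> conj x * x = 1.
Proof.
move=> xp xx; apply/eqP; rewrite -subr_eq0; apply/eqP.
apply/matrixP => i j; rewrite [RHS]mxE.
have := @posdef_ker R k _ x (col j (conj x * x - 1 : B)) xp.
rewrite colE mulmxA; set z := conj x * x - 1.
have -> : x *m z = 0.
  by rewrite -[_ *m _]/(x * z) /z mulrBr mulrA xx mul1r mulr1 subrr.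
by rewrite mul0mx => /(_ erefl) /matrixP /(_ i 0); rewrite -colE !mxE.
Qed.

Lemma posdef_spin_unique (x y : B) :
  @spin_group R (scalars R k) n m.+1 V x -> @spin_group R (scalars R k) n m.+1 V y ->
  posdef x -> posdef y ->
  @Phi R (scalars R k) n m.+1 V x = @Phi R (scalars R k) n m.+1 V y -> x = y.
Proof.
move=> xS yS xp yp xy; have xM := spin_acts xS; have yM := spin_acts yS.
case: xS yS => x_even xx _ [y_even yy _].
have {}xx : x * conj x = 1 by [].
have {}yy : y * conj y = 1 by [].
have xx' := posdef_spin_conjV xp xx; have yy' := posdef_spin_conjV yp yy.
have [r zr] : exists r : R, conj y * x = r%:A.
  apply: even_central_scalar => [|j].
    by apply: evenM => //; exact: even_conj.
  (* The factor x V_j x^cc equals y V_j y^cc, since x and y act by the same matrix; then y^cc y = 1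
     cancels on the left. *)
  have -> : conj y * x * V j = conj y * (x * V j * conj x) * x.
    by rewrite -!mulrA xx' mulr1.
  by rewrite xM xy -yM !mulrA yy' mul1r.
have xry : x = r *: y by rewrite -[x]mul1r -yy -mulrA zr -scalerAr mulr1.
have r0 : 0 < r by apply: (posdef_scale_gt0 yp); rewrite -[rscale _ _]xry.
have Ay := even_alg y_even.
(* From 1 = x x^cc = r^2 y y^cc = r^2. *)
have : (r ^+ 2)%:A = 1 :> B.
  by rewrite -[RHS]xx xry conjZ // -scalerAl -scalerAr yy scalerA expr2.
rewrite -[1 in RHS]scale1r => /eqP; rewrite -subr_eq0 -scalerBl scaler_eq0.
rewrite oner_eq0 orbF subr_eq0 sqrf_eq1 => /orP[] /eqP r1.
  by rewrite xry r1 scale1r.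
by move: r0; rewrite r1 ltr0N1.
Qed.

(** * Boosts as self-adjoint elements of the spin group *)

Section SpinBoost.
Variables (u w : 'rV[R]_n).
Hypotheses (u_space : forall i, u 0 i * signature R i = u 0 i)
  (w_time : forall i, w 0 i * signature R i = - w 0 i)
  (u1 : \sum_i u 0 i ^+ 2 = 1) (w1 : \sum_i w 0 i ^+ 2 = 1).
Local Notation U := (one_vector V u).
Local Notation W := (one_vector V w).
Local Notation h := (boost U W).

Lemma even_boost c s : even (h c s).
Proof.
apply: real_spanD; apply: real_spanZ; first exact: even1.
rewrite /one_vector mulr_suml; apply: real_span_sum => i.
rewrite mulr_sumr; apply: real_span_sum => j.
rewrite -scalerAl -scalerAr; do 2 apply: real_spanZ.
exact: even_generatorM.
Qed.

Let WU : W * U = - (U * W).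
Proof. exact: time_space_anticomm. Qed.

Lemma conj_boost c s : conj (h c s) = h c (- s).
Proof.
have [Au cu] := conj_one_vector u; have [Aw cw] := conj_one_vector w.
have Auw := algM Au Aw.
rewrite /boost conjD; [|apply: real_spanZ; exact: alg1|exact: real_spanZ].
rewrite !conjZ //; last exact: alg1.
by rewrite conj1 conjM // cu cw mulrNN WU scalerN scaleNr.
Qed.

(** As U^* = U and W^* = - W, the adjoint of U W is W^* U^* = - W U = U W. *)
Lemma adj_boost c s : adj (h c s) = h c s.
Proof.
have uE : adj U = U.
  by rewrite -[RHS]scale1r; apply: adj_one_vector => i; rewrite mul1r.
have wE : adj W = - W.
  by rewrite -scaleN1r; apply: adj_one_vector => i; rewrite mulN1r.
by rewrite /boost adjD !adjZ adj1 adjM uE wE mulNr WU opprK.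
Qed.

Lemma boostK c s : c ^+ 2 - s ^+ 2 = 1 -> h c s * conj (h c s) = 1.
Proof.
move=> cs; rewrite conj_boost boostV //.
- exact: space_vector_sqr.
- exact: time_vector_sqr.
Qed.

Lemma acts_boost c s : c ^+ 2 - s ^+ 2 = 1 -> acts (h c s) (boost_mx u w c s).
Proof. by move=> cs j; rewrite conj_boost boost_generator. Qed.

Lemma boost_sandwich_spin c s (x : B) M : c ^+ 2 - s ^+ 2 = 1 ->
  even x -> x * conj x = 1 -> acts x M ->
  [/\ even (h c s * x * h c s), h c s * x * h c s * conj (h c s * x * h c s) = 1 &
    acts (h c s * x * h c s) (boost_mx u w c s *m M *m boost_mx u w c s)].
Proof.
move=> cs x_even xx xM; have he := even_boost c s; have hh := boostK cs.
have [Ax Ah] := (even_alg x_even, even_alg he).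
have Ahx := algM Ah Ax; split.
- by do 2 apply: evenM => //.
- rewrite conjM // conjM // -!mulrA (mulrA (h c s) (conj _)) hh mul1r.
  by rewrite (mulrA x) xx mul1r.
- apply: actsM => //; last exact: acts_boost.
  by apply: actsM => //; exact: acts_boost.
Qed.

(** Since h is self-adjoint, h x h is the congruence h^* x h, and h is injective because changing
    the sign of s inverts it. *)
Lemma boost_sandwich_posdef c s (x : B) : c ^+ 2 - s ^+ 2 = 1 ->
  @posdef R (scalars R k) m.+1 x ->
  @posdef R (scalars R k) m.+1 (h c s * x * h c s).
Proof.
move=> cs xp; rewrite -{1}adj_boost; apply: (@posdef_congr R k _ x (h c s)) => // v hv.
have hh : h c (- s) * h c s = 1.
  rewrite -{2}[s]opprK; apply: boostV; rewrite ?sqrrN //.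
  - exact: space_vector_sqr.
  - exact: time_vector_sqr.
rewrite -[v]mul1mx -[1%:M]/(1 : B) -hh.
by rewrite -[_ * _]/(_ *m _) -mulmxA hv mulmx0.
Qed.

End SpinBoost.

End SpinGroup.

(** * Connectedness of the boosts *)

Lemma real_complex_continuous (R : realType) (f : R -> R) :
  continuous f -> continuous (fun s => Complex (f s) 0 : R[i]^o).
Proof.
move=> fc s; apply/cvgrPdist_lt => -[e e'].
rewrite ltcE /= => /andP[/eqP -> e0].
have /cvgrPdist_lt/(_ e e0) := fc s; apply: filterS => t.
rewrite -[Complex (f s) 0]/((f s)%:C)%C -[Complex (f t) 0]/((f t)%:C)%C.
by rewrite -raddfB normc_def /= expr0n addr0 sqrtr_sqr ltcR.
Qed.

(** Three terms suffice because h x h is quadratic in (c, s), with coefficients c^2, c s and s^2.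
    Over H the topology is the initial one for the coordinates, so continuity is checked on
    these. *)
Lemma real_comb_continuous (R : realType) (k : division_algebra)
    (f g h : R -> R) (a b c : scalars R k) :
  continuous f -> continuous g -> continuous h ->
  continuous (fun s => sreal (f s) * a + sreal (g s) * b + sreal (h s) * c).
Proof.
have comb (f' g' h' : R -> R) (x y z : R) : continuous f' -> continuous g' ->
    continuous h' -> continuous (fun s => f' s * x + g' s * y + h' s * z).
  have mul (F : R -> R) v s : continuous F -> F t * v @[t --> s] --> F s * v.
    by move=> Fc; apply: cvgM; [exact: Fc|exact: cvg_cst].
  by move=> fc gc hc s; apply: cvgD; [apply: cvgD|]; exact: mul.
move=> fc gc hc; case: k a b c => a b c.
- exact: comb.
- move=> s; pose r (F : R -> R) t : R[i]^o := Complex (F t) 0.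
  have rc F : continuous F -> r F @ s --> r F s.
    by move=> Fc; exact: real_complex_continuous.
  apply: (@cvgD _ R[i]^o); first apply: (@cvgD _ R[i]^o);
  by apply: (@cvgM R[i] _ _ _ _ (fun=> _)); [exact: rc|exact: cvg_cst].
- pose F s : quaternion R := sreal (f s) * a + sreal (g s) * b + sreal (h s) * c.
  have cF : continuous (@quaternion_coords R \o F).
    have -> : @quaternion_coords R \o F = fun s =>
      (f s * qr a + g s * qr b + h s * qr c, f s * qi a + g s * qi b + h s * qi c,
       f s * qj a + g s * qj b + h s * qj c, f s * qk a + g s * qk b + h s * qk c).
      apply/funext => s; rewrite /F /quaternion_coords /=.
      by congr (_, _, _, _); ring.
    have pairc (T U : topologicalType) (f' : R -> T) (g' : R -> U) :
        continuous f' -> continuous g' -> continuous (fun s => (f' s, g' s)).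
      by move=> fc' gc' s; exact: (cvg_pair (fc' s) (gc' s)).
    by do 3 (apply: (pairc); last exact: comb); exact: comb.
  apply/continuousP => A [B oB <-].
  exact: (@continuousP _ _ (@quaternion_coords R \o F)).1.
Qed.

(** A neighbourhood of a matrix contains a product of neighbourhoods of its entries, and finitely
    many conditions valid near s hold together near s. *)
Lemma real_comb_mx_continuous (R : realType) (k : division_algebra) (m : nat)
    (f g h : R -> R) (A B C : matalg R k m) :
  continuous f -> continuous g -> continuous h ->
  continuous (fun s => f s *: A + g s *: B + h s *: C : 'M[scalars R k]_m.+1).
Proof.
move=> fc gc hc s S [P nP sPS].
pose Q i j t := P i j ((f t *: A + g t *: B + h t *: C : 'M[scalars R k]_m.+1) i j).
have : \forall t \near s, forall i j, Q i j t.
  refine (@filter_forall R _ (fun i t => forall j, Q i j t) (nbhs s) _ _) => i.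
  refine (@filter_forall R _ (Q i) (nbhs s) _ _) => j; rewrite /Q.
  have := @real_comb_continuous R k f g h (A i j) (B i j) (C i j) fc gc hc s.
  move=> /(_ (P i j)).
  have := nP i j; rewrite !mxE => Pij /(_ Pij).
  by refine (@filterS _ (nbhs s) _ _ _ _) => t /=; rewrite !mxE.
by refine (@filterS _ (nbhs s) _ _ _ _) => t; exact: sPS.
Qed.

Section SpinPath.
Variables (R : realType) (k : division_algebra) (m p q : nat).
Local Notation B := (matalg R k m).
Local Notation n := (p + q)%N.
Variable V : 'I_n -> B.
Local Notation alg := (@generated_algebra R (scalars R k) n m.+1 V).
Local Notation even := (@even_elements R (scalars R k) n m.+1 V).
Hypothesis basisV : @one_vector_basis R (scalars R k) p q m.+1 V.
Hypothesis adjV : forall i, @adjmx R (scalars R k) _ _ (V i) = V i \/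
  @adjmx R (scalars R k) _ _ (V i) = - V i.
Variables (u w : 'rV[R]_n).
Hypotheses (u_space : forall i, u 0 i * signature R i = u 0 i)
  (w_time : forall i, w 0 i * signature R i = - w 0 i)
  (u1 : \sum_i u 0 i ^+ 2 = 1) (w1 : \sum_i w 0 i ^+ 2 = 1).
Local Notation h := (boost (one_vector V u) (one_vector V w)).

(** With h_t = sqrt(1 + t^2) + t U W, the path h_t x h_t stays in the spin group and passes through
    x at t = 0 and through h x h at t = s. *)
Lemma boost_sandwich_spin_plus c s (x : B) M : c ^+ 2 - s ^+ 2 = 1 -> 0 <= c ->
  @spin_plus R (scalars R k) n m.+1 V x -> acts V x M ->
  @spin_plus R (scalars R k) n m.+1 V (h c s * x * h c s).
Proof.
move=> cs c0 x_plus xM; apply: (connected_component_trans x_plus).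
have [x_even xx _] := connected_component_sub x_plus.
pose ch t : R := Num.sqrt (1 + t ^+ 2).
have chP t : ch t ^+ 2 - t ^+ 2 = 1.
  by rewrite sqr_sqrtr ?addrK // addr_ge0 // sqr_ge0.
(* The condition c >= 0 selects the branch of the hyperbola that contains (1, 0). *)
have cE : c = ch s.
  by rewrite /ch -cs subrK sqrtr_sqr ger0_norm.
pose Z t : B := h (ch t) t * x * h (ch t) t.
have Z0 : Z 0 = x.
  by rewrite /Z /boost /ch expr0n addr0 sqrtr1 !scale1r !scale0r addr0 mul1r mulr1.
have spinZ t : @spin_group R (scalars R k) n m.+1 V (Z t).
  have [] := boost_sandwich_spin basisV adjV u_space w_time u1 w1 (chP t) x_even xx xM.
  exact: spin_groupP.
pose N : B := one_vector V u * one_vector V w.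
have ZE t : Z t = (ch t ^+ 2) *: x + (ch t * t) *: (N * x + x * N)
    + (t ^+ 2) *: (N * x * N).
  rewrite /Z /boost -/N mulrDr !mulrDl -!scalerAr -!scalerAl !mul1r !mulr1.
  by rewrite !(scalerA, addrA) -!expr2 [t * ch t]mulrC scalerDr !addrA.
have cZ : continuous (Z : R -> 'M[scalars R k]_m.+1).
  have -> : Z = fun t => (ch t ^+ 2) *: x + (ch t * t) *: (N * x + x * N)
    + (t ^+ 2) *: (N * x * N) by apply/funext.
  have sqr_continuous : continuous (fun t : R => t ^+ 2) by exact: exprn_continuous.
  have ch_continuous : continuous ch.
    move=> t; apply: (@continuous_comp _ _ _ (fun t : R => 1 + t ^+ 2) Num.sqrt).
      by apply: cvgD; [exact: cvg_cst|exact: sqr_continuous].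
    exact: sqrt_continuous.
  apply: real_comb_mx_continuous => // t.
    by apply: (@continuous_comp _ _ _ ch (fun t : R => t ^+ 2));
      [exact: ch_continuous|exact: sqr_continuous].
  by apply: cvgM; [exact: ch_continuous|exact: cvg_id].
apply: (@connected_component_max _ _ (range (Z : R -> 'M[scalars R k]_m.+1))).
- by exists 0.
- by move=> _ [t _ <-].
- apply: connected_continuous_connected.
    by apply/connected_intervalP.
  exact: continuous_subspaceT.
- by exists s => //; rewrite /Z -cE.
Qed.

End SpinPath.

(** * Reduction of positive definite matrices of SO(p, q) *)

(** The complexification of L is Hermitian, hence unitarily diagonalizable with real eigenvalues,
    not all zero as L is nonzero. *)
Lemma real_symmetric_eigen (R : realType) (n : nat) (L : 'M[R]_n) :
  L^T = L -> L != 0 ->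
  exists mu : R, exists v : 'rV[R]_n, [/\ mu != 0, v != 0 & v *m L = mu *: v].
Proof.
move=> Ls L0; pose A := map_mx (real_complex R) L.
have Ah : A \is hermsymmx.
  apply/is_hermitianmxP; rewrite expr0 scale1r; apply/matrixP => i j.
  by rewrite !mxE -[in LHS]Ls mxE; symmetry; exact: conjc_real.
have /hermitian_normalmx/orthomx_spectralP := Ah.
set S := spectralmx A; set d := spectral_diag A => AE.
have Su : S \in unitmx by exact: spectral_unit.
have [i di] : exists i, d 0 i != 0.
  apply: contrapT => nd; case/negP: L0; apply/eqP.
  apply: (@map_mx_inj _ _ (real_complex R)).
  rewrite -/A AE map_mx0 (_ : d = 0) ?raddf0 ?mulmx0 ?mul0mx //.
  apply/matrixP => a b; rewrite ord1 [RHS]mxE; apply: contrapT => /eqP ab.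
  by apply: nd; exists b.
have [mu dE] : exists mu : R, d 0 i = mu%:C%C.
  apply/complex_realP; have /mxOverP := hermitian_spectral_diag_real Ah.
  exact.
have muN0 : mu != 0 by apply: contraNneq di => mu0; rewrite dE mu0.
have rowAE : row i S *m A = d 0 i *: row i S.
  rewrite -row_mul AE !mulmxA mulmxV // mul1mx.
  by rewrite row_mul row_diag_mx -scalemxAl -rowE.
have rowN0 : row i S != 0.
  by apply/negP => /eqP /(congr1 (mulmx^~ (invmx S))); rewrite mul0mx -row_mul mulmxV //;
    move=> /matrixP/(_ 0 i)/eqP; rewrite !mxE eqxx oner_eq0.
(* As L and the eigenvalue are real, the real and imaginary parts of the eigenvector satisfy the
   same equation; one of them is nonzero. *)
pose re := map_mx (@complex.Re R) (row i S); pose im := map_mx (@complex.Im R) (row i S).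
have reE : re *m L = mu *: re.
  apply/matrixP => a b; have /matrixP/(_ a b)/(congr1 (@complex.Re R)) := rowAE.
  rewrite dE !mxE /= raddf_sum; case: (S i b) => x y /=; rewrite mul0r subr0 => <-.
  by apply: eq_bigr => l _; rewrite !mxE; case: (S i l) => x' y' /=; rewrite mulr0 subr0.
have imE : im *m L = mu *: im.
  apply/matrixP => a b; have /matrixP/(_ a b)/(congr1 (@complex.Im R)) := rowAE.
  rewrite dE !mxE /= raddf_sum; case: (S i b) => x y /=; rewrite mul0r addr0 => <-.
  by apply: eq_bigr => l _; rewrite !mxE; case: (S i l) => x' y' /=; rewrite mulr0 add0r.
exists mu; have [re0|reN0] := eqVneq re 0; last by exists re.
exists im; split=> //; apply: contraNneq rowN0 => im0.
apply/eqP/matrixP => a b.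
have /matrixP/(_ a b) := re0; have /matrixP/(_ a b) := im0; rewrite !mxE.
by case: (S i b) => x y /= -> ->.
Qed.

Section Reduction.
Variables (R : realType) (p q : nat).
Local Notation n := (p + q)%N.
Local Notation J := (Ipq R p q).
Implicit Types (u v w x : 'rV[R]_n) (P : 'M[R]_n).

Lemma IpqE : J = diag_mx (\row_i signature R i).
Proof.
apply/matrixP => i j; rewrite !mxE /signature.
case: (split_ordP i) => i' ->; rewrite mxE; case: (split_ordP j) => j' ->;
  rewrite !mxE ?eq_lshift ?eq_rshift ?eq_lrshift ?eq_rlshift /= ?ltn_ord //.
by rewrite mulNrn.
Qed.

Lemma tr_Ipq : J^T = J.
Proof. by rewrite IpqE tr_diag_mx. Qed.

Lemma mul_rV_IpqE v i : (v *m J) 0 i = v 0 i * signature R i.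
Proof. by rewrite IpqE mul_mx_diag !mxE. Qed.

Lemma Ipq_sqr : J *m J = 1%:M.
Proof.
rewrite IpqE mulmx_diag -diag_const_mx; congr diag_mx.
by apply/matrixP => i j; rewrite !mxE signatureM.
Qed.

Definition dot u v : R := \sum_i u 0 i * v 0 i.

Lemma dotE u v : u *m v^T = (dot u v)%:M.
Proof.
apply/matrixP => i j; rewrite !ord1 !mxE mulr1n; apply: eq_bigr => l _.
by rewrite mxE.
Qed.

Lemma dotC u v : dot u v = dot v u.
Proof. by apply: eq_bigr => i _; rewrite mulrC. Qed.

Lemma dotDr u v w : dot u (v + w) = dot u v + dot u w.
Proof. by rewrite -big_split; apply: eq_bigr => i _; rewrite mxE mulrDr. Qed.

Lemma dotZr (r : R) u v : dot u (r *: v) = r * dot u v.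
Proof. by rewrite mulr_sumr; apply: eq_bigr => i _; rewrite mxE mulrCA. Qed.

Lemma dot_mx u v P : dot (u *m P) v = dot u (v *m P^T).
Proof.
have : (dot (u *m P) v)%:M = (dot u (v *m P^T))%:M :> 'M[R]_1.
  by rewrite -!dotE trmx_mul trmxK mulmxA.
by move/matrixP/(_ 0 0); rewrite !mxE !mulr1n.
Qed.

Lemma dot_gt0 v : v != 0 -> 0 < dot v v.
Proof.
move=> v0; rewrite lt_neqAle sumr_ge0 ?andbT; last by move=> i _; rewrite -expr2 sqr_ge0.
apply: contraNneq v0 => /esym /psumr_eq0P vv; apply/eqP/matrixP => i j.
rewrite ord1 mxE; apply/eqP; rewrite -sqrf_eq0 expr2; apply/eqP/vv => // l _.
by rewrite -expr2 sqr_ge0.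
Qed.

(** * The matrix of a boost as an element of O(p, q) *)

Section BoostMatrix.
Variables u w : 'rV[R]_n.
Hypotheses (uu : dot u u = 1) (ww : dot w w = 1) (uw : dot u w = 0)
  (uJ : u *m J = u) (wJ : w *m J = - w).
Local Notation H := (boost_mx u w).

Lemma tr_boost_mx c s : (H c s)^T = H c s.
Proof.
by apply/matrixP => i j; rewrite !mxE !big_ord1 !mxE eq_sym; ring.
Qed.

Lemma mul_rV_boost_mx x c s :
  x *m H c s = x - (2 * (c * s)) *: (dot x u *: w + dot x w *: u)
     + (2 * s ^+ 2) *: (dot x u *: u + dot x w *: w).
Proof.
by rewrite /boost_mx mulmxDr mulmxBr mulmx1 -!scalemxAr !mulmxDr !mulmxA !dotE
  !mul_scalar_mx.
Qed.

(** The isotropic vector u + w is an eigenvector, of eigenvalue exp(-2t) if c = cosh t and s = sinh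
    t. *)
Lemma boost_mx_plus c s : c ^+ 2 - s ^+ 2 = 1 ->
  (u + w) *m H c s = (c - s) ^+ 2 *: (u + w).
Proof.
move=> cs; have -> : (c - s) ^+ 2 = 1 - 2 * (c * s) + 2 * s ^+ 2.
  by lra.
rewrite mul_rV_boost_mx ![dot (u + w) _]dotC !dotDr uu ww uw (dotC w u) uw.
by rewrite addr0 add0r !scale1r [w + u]addrC scalerDl scalerBl scale1r.
Qed.

Lemma boost_mx_fix x c s : dot x u = 0 -> dot x w = 0 -> x *m H c s = x.
Proof.
move=> xu xw; rewrite mul_rV_boost_mx xu xw.
by rewrite !scale0r !addr0 !scaler0 subr0 addr0.
Qed.

Lemma boost_mxV c s : c ^+ 2 - s ^+ 2 = 1 -> H c s *m H c (- s) = 1%:M.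
Proof.
move=> cs; have outer (x y z t : 'rV[R]_n) :
    (x^T *m y) *m (z^T *m t) = dot y z *: (x^T *m t).
  by rewrite -mulmxA (mulmxA y) dotE mul_scalar_mx scalemxAr.
have wu : dot w u = 0 by rewrite dotC.
rewrite /boost_mx; set M := u^T *m w + _; set Q := u^T *m u + _.
(* [Q] is the projection onto the plane and [M] exchanges u and w, so that (1 - aM + bQ)(1 + aM +
   bQ) = 1 + (2b + b^2 - a^2) Q. *)
have MM : M *m M = Q.
  rewrite mulmxDl !mulmxDr !outer uu ww uw wu !scale0r !scale1r.
  by rewrite addr0 add0r.
have MQ : M *m Q = M.
  by rewrite mulmxDl !mulmxDr !outer uu ww uw wu !scale0r !scale1r addr0 add0r.
have QM : Q *m M = M.
  by rewrite mulmxDl !mulmxDr !outer uu ww uw wu !scale0r !scale1r addr0 add0r.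
have QQ : Q *m Q = Q.
  by rewrite mulmxDl !mulmxDr !outer uu ww uw wu !scale0r !scale1r addr0 add0r.
set a := 2 * (c * s); set b := 2 * s ^+ 2.
have -> : 2 * (c * - s) = - a by rewrite /a; ring.
have -> : 2 * (- s) ^+ 2 = b by rewrite sqrrN.
have ab : b + b + b * b = a * a.
  have c2 : c ^+ 2 = 1 + s ^+ 2 by lra.
  have -> : a * a = 4 * c ^+ 2 * s ^+ 2 by rewrite /a; ring.
  by rewrite c2 /b; ring.
rewrite scaleNr opprK !mulmxDl !mulmxDr !mul1mx !mulmx1 !mulNmx.
rewrite -!scalemxAl -!scalemxAr MM MQ QM QQ.
clearbody M Q a b; apply/matrixP => i j; rewrite !mxE.
set e := _%:R; transitivity (e + (b + b + b * b - a * a) * Q i j); first ring.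
by rewrite ab subrr mul0r addr0.
Qed.

(** J fixes u and negates w, which changes the sign of the mixed term and so of s. Together with
    [boost_mxV] this shows that a boost preserves J. *)
Lemma Ipq_boost_mx c s : H c (- s) *m J = J *m H c s.
Proof.
have uJ' : J *m u^T = u^T by rewrite -[RHS](congr1 trmx uJ) trmx_mul tr_Ipq.
have wJ' : J *m w^T = - w^T by rewrite -linearN /= -[in RHS]wJ trmx_mul tr_Ipq.
rewrite /boost_mx !mulmxDl !mulmxDr mulNmx mulmxN mul1mx mulmx1.
rewrite -!scalemxAl -!scalemxAr !mulmxDl !mulmxDr -!mulmxA uJ wJ.
rewrite !mulmxA uJ' wJ' !mulNmx !mulmxN.
by apply/matrixP => i j; rewrite !mxE !big_ord1 !mxE; ring.
Qed.

End BoostMatrix.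

Definition sym_posdef P :=
  P^T = P /\ forall v, v != 0 -> 0 < dot (v *m P) v.

Lemma hyperbolic_plane P : sym_posdef P -> P *m J *m P = J -> P != 1%:M ->
  exists lambda : R, exists u : 'rV[R]_n, exists w : 'rV[R]_n,
    [/\ 0 < lambda, lambda != 1 &
        [/\ dot u u = 1, dot w w = 1 & dot u w = 0] /\
        [/\ u *m J = u, w *m J = - w,
            (u + w) *m P = lambda *: (u + w) &
            (u - w) *m P = lambda^-1 *: (u - w)]].
Proof.
move=> [Ps Pp] PJP P1.
have [||mu [v [mu0 v0 vL]]] := @real_symmetric_eigen R n (P - 1%:M).
- by rewrite linearB /= Ps trmx1.
- by rewrite subr_eq0.
pose lambda := mu + 1.
have vP : v *m P = lambda *: v.
  by rewrite -[P](subrK 1%:M) mulmxDr vL mulmx1 scalerDl scale1r.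
have l0 : 0 < lambda.
  have := Pp v v0; rewrite vP dotC dotZr pmulr_lgt0 //; exact: dot_gt0.
have lN0 : lambda != 0 by rewrite gt_eqF.
have l1 : lambda != 1 by rewrite -subr_eq0 addrK.
have vJP : v *m J *m P = lambda^-1 *: (v *m J).
  by rewrite -[in RHS]PJP !mulmxA vP -!scalemxAl scalerA mulVf // scale1r.
(* v and v J are eigenvectors of the symmetric P for lambda and 1 / lambda; these eigenvalues
   differ, since lambda > 0 and lambda <> 1. *)
have vJv : dot v (v *m J) = 0.
  have E : lambda * dot v (v *m J) = lambda^-1 * dot v (v *m J).
    by rewrite -[RHS]dotZr -vJP -[in RHS]Ps -dot_mx vP [RHS]dotC dotZr [in RHS]dotC.
  have /eqP : (lambda ^+ 2 - 1) * dot v (v *m J) = 0.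
    by rewrite mulrBl expr2 -mulrA E mulrA divff // mul1r subrr.
  rewrite mulf_eq0 subr_eq0 sqrf_eq1 (negPf l1) /= => /orP[/eqP lN|/eqP //].
  by move: l0; rewrite lN ltr0N1.
have vJJ : v *m J *m J = v by rewrite -mulmxA Ipq_sqr mulmx1.
have vJvJ : dot (v *m J) (v *m J) = dot v v.
  by rewrite dot_mx tr_Ipq vJJ.
have vv := dot_gt0 v0.
(* Since v J is orthogonal to v and has the same length, both v + v J and v - v J have squared
   length 2 |v|^2. *)
pose nu := (Num.sqrt (2 * dot v v))^-1.
have nu2 : nu * nu * (2 * dot v v) = 1.
  rewrite /nu -invfM -expr2 sqr_sqrtr ?mulVf //; last first.
    by apply: mulr_ge0 => //; exact: ltW.
  by apply: mulf_neq0; [rewrite pnatr_eq0|rewrite gt_eqF].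
(* v + v J and v - v J are twice the components of v in R^p and R^q. *)
pose u := nu *: (v + v *m J); pose w := nu *: (v + (-1) *: (v *m J)).
have dotE' (a b c d : R) : dot (a *: (v + b *: (v *m J))) (c *: (v + d *: (v *m J)))
    = a * c * (1 + b * d) * dot v v.
  rewrite dotZr dotC dotZr dotDr !dotZr ![dot (v + _) _]dotC !dotDr !dotZr.
  by rewrite vJvJ vJv [dot (v *m J) v]dotC vJv; ring.
have uE : u = nu *: (v + 1 *: (v *m J)) by rewrite scale1r.
have uDw : u + w = (nu * 2) *: v.
  by rewrite -scalerDr addrACA scaleN1r subrr addr0 -mulr2n -scaler_nat scalerA.
have uBw : u - w = (nu * 2) *: (v *m J).
  rewrite -scalerBr scaleN1r opprB addrC addrA subrK.
  by rewrite -mulr2n -scaler_nat scalerA.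
exists lambda, u, w; split=> //; split; split.
- by rewrite uE dotE' -[RHS]nu2; ring.
- by rewrite /w dotE' mulrNN mulr1 -[RHS]nu2; ring.
- by rewrite uE /w dotE'; ring.
- by rewrite /u -scalemxAl mulmxDl vJJ addrC.
- by rewrite /w -scalemxAl mulmxDl -scalemxAl vJJ -scalerN opprD !scaleN1r opprK addrC.
- by rewrite uDw -scalemxAl vP !scalerA mulrC.
- by rewrite uBw -scalemxAl vJP !scalerA mulrC.
Qed.

(* Conjugating P by the boost which takes the square root of P on the plane
   (u, w) makes P the identity on that plane, and leaves the other fixed vectors
   of P, which are orthogonal to it, fixed. *)
Lemma boost_reduction P : sym_posdef P -> P *m J *m P = J -> P != 1%:M ->
  exists u : 'rV[R]_n, exists w : 'rV[R]_n, exists c : R, exists s : R,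
    [/\ dot u u = 1, dot w w = 1, u *m J = u & w *m J = - w] /\
    [/\ c ^+ 2 - s ^+ 2 = 1, 0 <= c &
      exists P' : 'M[R]_n,
      [/\ sym_posdef P', P' *m J *m P' = J,
          (\rank (P' - 1%:M)%R < \rank (P - 1%:M)%R)%N &
          P = boost_mx u w c s *m P' *m boost_mx u w c s]].
Proof.
move=> Pp PJP P1.
have [l [u [w [l0 l1 [[uu ww uw] [uJ wJ uDw uBw]]]]]] := hyperbolic_plane Pp PJP P1.
have lN0 : l != 0 by rewrite gt_eqF.
(* A fourth root of l: the boost multiplies u + w by (c - s)^2 and occurs twice in H P' H, so c - s
   must be l^(1/4). *)
pose r := Num.sqrt (Num.sqrt l).
have r0 : 0 < r by rewrite !sqrtr_gt0.
have rN0 : r != 0 by rewrite gt_eqF.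
have r4 : r ^+ 2 * r ^+ 2 = l.
  by rewrite sqr_sqrtr ?sqrtr_ge0 // -expr2 sqr_sqrtr // ltW.
(* The solution of c - s = r and c + s = 1 / r. *)
pose c := (r + r^-1) / 2; pose s := (r^-1 - r) / 2.
have cs : c ^+ 2 - s ^+ 2 = 1 by rewrite /c /s; field.
have cs' : c ^+ 2 - (- s) ^+ 2 = 1 by rewrite sqrrN.
have c0 : 0 <= c by apply: divr_ge0 => //; apply: addr_ge0; rewrite ?invr_ge0 ltW.
exists u, w, c, s; split=> //; split=> //.
pose G := boost_mx u w c (- s); pose H := boost_mx u w c s.
have GH : G *m H = 1%:M by rewrite /H -[s]opprK; exact: boost_mxV.
have HG : H *m G = 1%:M by exact: boost_mxV.
have GT : G^T = G by exact: tr_boost_mx.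
have GJG : G *m J *m G = J.
  by rewrite (Ipq_boost_mx uJ wJ) -mulmxA HG mulmx1.
have csr : (c + s) ^+ 2 = (r ^+ 2)^-1 by rewrite /c /s; field.
have uDwG : (u + w) *m G = (r ^+ 2)^-1 *: (u + w).
  by rewrite (boost_mx_plus uu ww uw cs') opprK csr.
pose P' := G *m P *m G.
have [Ps Ppos] := Pp.
exists P'; split.
- split; first by rewrite !trmx_mul GT Ps mulmxA.
  move=> x x0; rewrite /P' !mulmxA dot_mx GT; apply: Ppos.
  by apply: contraNneq x0 => xG; rewrite -[x]mulmx1 -GH mulmxA xG mul0mx.
- rewrite /P' !mulmxA -(mulmxA _ G J) -(mulmxA _ (G *m J) G) GJG.
  by rewrite -!mulmxA (mulmxA P) (mulmxA (P *m J)) PJP !mulmxA GJG.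
(* The rank drops because the space of vectors fixed by P is strictly contained in the space of
   vectors fixed by P'. *)
- rewrite -(ltn_sub2lE _ (rank_leq_row _)) -!mxrank_ker; apply: rank_ltmx.
  have kerE (M : 'M[R]_n) (x : 'rV[R]_n) : (x <= kermx (M - 1%:M))%MS = (x *m M == x).
    by rewrite sub_kermx mulmxBr mulmx1 subr_eq0.
  rewrite /ltmx; apply/andP; split.
    apply/rV_subP => x; rewrite !kerE => /eqP xP; apply/eqP.
    (* A fixed vector of the symmetric P is orthogonal to its eigenvectors for eigenvalues other
       than 1, hence to u + w and u - w. *)
    have orth z (a : R) : z *m P = a *: z -> a != 1 -> dot x z = 0.
      move=> zP a1; have : dot x z = a * dot x z.
        by rewrite -dotZr -zP -[in RHS]Ps -dot_mx xP.
      move=> /eqP; rewrite -subr_eq0 -{1}[dot x z]mul1r -mulrBl mulf_eq0.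
      by rewrite subr_eq0 eq_sym (negPf a1) => /eqP.
    have xp := orth _ _ uDw l1.
    have xm : dot x (u - w) = 0 by apply: orth uBw _; rewrite invr_eq1.
    move: xp xm; rewrite -[- w]scaleN1r !dotDr dotZr => xp xm.
    have xu : dot x u = 0 by lra.
    have xw : dot x w = 0 by lra.
    have xG : x *m G = x by exact: boost_mx_fix.
    by rewrite /P' !mulmxA xG xP xG.
  (* Strictness: u + w is fixed by P' but multiplied by l <> 1 under P. *)
  apply/negP => /rV_subP /(_ (u + w)); rewrite !kerE.
  have -> : (u + w) *m P' = u + w.
    rewrite /P' !mulmxA uDwG -!scalemxAl uDw -!scalemxAl uDwG !scalerA.
    rewrite (_ : _ * _ = 1) ?scale1r // -r4.
    by field.
  move=> /(_ (eqxx _)); rewrite uDw => /eqP /(congr1 (dot u)).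
  rewrite dotZr dotDr uu uw addr0 mulr1 => /eqP.
  by rewrite (negPf l1).
- rewrite /P' !mulmxA HG mul1mx -mulmxA.
  by rewrite GH mulmx1.
Qed.

End Reduction.

(** * The positive definite lift *)

Section PositiveLift.
Variables (R : realType) (k : division_algebra) (m p q : nat).
Local Notation B := (matalg R k m).
Local Notation n := (p + q)%N.
Variable V : 'I_n -> B.
Hypothesis basisV : @one_vector_basis R (scalars R k) p q m.+1 V.
Hypothesis adjV : forall i, @adjmx R (scalars R k) _ _ (V i) = V i \/
  @adjmx R (scalars R k) _ _ (V i) = - V i.

Lemma posdef_lift (P : 'M[R]_n) :
  sym_posdef P -> P *m Ipq R p q *m P = Ipq R p q ->
  exists Y : B, [/\ @spin_plus R (scalars R k) n m.+1 V Y,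
    @posdef R (scalars R k) m.+1 Y & acts V Y P].
Proof.
have [N] := ubnP (\rank (P - 1%:M)); elim: N P => // N IHN P PN Pp PJP.
have [->|P1] := eqVneq P 1%:M.
  exists 1; split; [|exact: posdef1|exact: acts1].
  apply: connected_component_refl.
  apply: (@spin_groupP _ _ _ _ _ V _ 1%:M); first exact: even1.
    by rewrite mul1r; exact: conj1.
  exact: acts1.
have [u [w [c [s [[uu ww uJ wJ] [cs c0 [P' [P'p P'J P'P PE]]]]]]]] :=
  boost_reduction Pp PJP P1.
have [Y [Y_plus Yp YP']] := IHN P' (leq_trans P'P PN) P'p P'J.
have u_space i : u 0 i * signature R i = u 0 i by rewrite -mul_rV_IpqE uJ.
have w_time i : w 0 i * signature R i = - w 0 i by rewrite -mul_rV_IpqE wJ mxE.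
have [Y_even YY _] := connected_component_sub Y_plus.
exists (boost (one_vector V u) (one_vector V w) c s * Y
  * boost (one_vector V u) (one_vector V w) c s); split.
- exact: (boost_sandwich_spin_plus basisV adjV u_space w_time uu ww cs c0 Y_plus YP').
- exact: (boost_sandwich_posdef basisV adjV u_space w_time uu ww cs Yp).
- rewrite PE.
  by have [] := boost_sandwich_spin basisV adjV u_space w_time uu ww cs Y_even YY YP'.
Qed.

Lemma posdef_lift_unique (P : 'M[R]_n) :
  sym_posdef P -> P *m Ipq R p q *m P = Ipq R p q ->
  exists! Y : B, [/\ @spin_plus R (scalars R k) n m.+1 V Y,
    @posdef R (scalars R k) m.+1 Y & @Phi R (scalars R k) n m.+1 V Y = P].
Proof.
move=> Pp PJP; have [Y [Y_plus Yp YP]] := posdef_lift Pp PJP.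
have PhiY := Phi_acts basisV YP.
exists Y; split=> // Z [Z_plus Zp PhiZ].
apply: (posdef_spin_unique basisV adjV) => //; last by rewrite PhiY PhiZ.
  exact: connected_component_sub Y_plus.
exact: connected_component_sub Z_plus.
Qed.

End PositiveLift.

Lemma posdef_sym_posdef (R : realType) (p q : nat) (P : 'M[R]_(p + q)) :
  posdef (P : 'M[realK R]_(p + q)) -> sym_posdef P.
Proof.
move=> [Ps Pp]; have PT : P^T = P.
  by rewrite -[RHS]Ps; apply/matrixP => i j; rewrite !mxE.
split=> // v v0; have [|r r0] := Pp v^T.
  by apply: contraNneq v0 => /(congr1 trmx); rewrite trmxK trmx0 => ->.
have -> : @adjmx R (realK R) _ _ v^T = v by apply/matrixP => i j; rewrite !mxE.
by rewrite [_ *m v^T]dotE mxE mulr1n => ->.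
Qed.

(** Matrices of size 0 contain no nonempty free family, whereas the algebra has dimension at least
    1. This allows the size to be written [m.+1], for which the matrices form a nonzero ring. *)
Lemma one_vector_basis_size (R : realType) (K : scalarType R) (p q m : nat)
  (V : 'I_(p + q) -> 'M[K]_m) : one_vector_basis V -> (0 < m)%N.
Proof.
case: m V => // V [_ [b [b_free _]] _].
have i0 : 'I_(2 ^ (p + q)) by exists 0%N; rewrite expn_gt0.
have /(_ (fun=> 1) _ i0) := b_free.
by rewrite (flatmx0 (\sum_i _)) => /(_ erefl) /eqP; rewrite oner_eq0.
Qed.

Theorem proposition13 (R : realType) (p q : nat) (k : division_algebra)
    (m : nat) (V : 'I_(p + q) -> 'M[scalars R k]_m) (P : 'M[R]_(p + q)) :
  one_vector_basis V ->
  (forall i, adjmx (V i) = V i \/ adjmx (V i) = - V i) ->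
  (forall i j, V i != V j -> trace_orthogonal (V i) (V j)) ->
  SO_plus P ->
  posdef (P : 'M[realK R]_(p + q)) ->
  exists! Y : 'M[scalars R k]_m,
    [/\ spin_plus V Y, posdef Y & Phi V Y = P].
Proof.
move=> basisV adjV _ P_plus Ppos.
have [PJP _] := connected_component_sub P_plus.
(* By symmetry of P the relation P^T J P = J becomes P J P = J. *)
have Pp := posdef_sym_posdef Ppos; rewrite Pp.1 in PJP.
have := one_vector_basis_size basisV; case: m V basisV adjV => // m V basisV adjV _.
exact: posdef_lift_unique.
Qed.
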